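(* Let $\mathbb{A}$ be a class of weakly saturated $\mathbf{FL_{ew}}$-chains such that for every $n\in\mathbb{N}$ there is some $\mathbf{A}_n\in\mathbb{A}$ that is not $n$-contractive. Then for any class of Kripke frames $\mathbb{F}$ with $\mathbb{L}\subseteq\mathbb{F}$, the logic $\vdash_{\mathbb{F}_{\mathbb{A}}}$ is undecidable. In particular, the logics $\vdash_{K\mathbb{A}}$ and $\vdash_{\omega K\mathbb{A}}$ are undecidable. More precisely, the three-variable fragments of all these logics (i.e. their restrictions to formulas built from three fixed propositional variables) are undecidable.
   Context: An $\mathbf{FL_{ew}}$-algebra is a structure $\mathbf{A}=\langle A;\wedge,\vee,\cdot,\rightarrow,0,1\rangle$ where $\langle A;\wedge,\vee,0,1\rangle$ is a bounded lattice, $\langle A;\cdot,1\rangle$ is a commutative monoid, and $a\cdot b\le c$ iff $a\le b\rightarrow c$ for all $a,b,c$. Write $ab=a\cdot b$, $a^n$ for the $n$-fold product, $\neg a=a\rightarrow 0$, $a\leftrightarrow b=(a\rightarrow b)\cdot(b\rightarrow a)$. A chain is a linearly ordered $\mathbf{FL_{ew}}$-algebra. $\mathbf{A}$ is $n$-contractive if $a^{n+1}=a^n$ for all $a\in A$. $\mathbf{A}$ is weakly saturated if for all $a,b\in A$: if $a\le b^n$ for all $n\in\mathbb{N}$ then $ab=a$. Modal formulas (set $Fm$) are built from a countable set $\mathcal{V}$ of propositional variables using $\wedge,\vee,\cdot,\rightarrow,\neg,\overline{0},\overline{1}$ and unary $\Box,\Diamond$. A Kripke frame is a pair $\langle W,R\rangle$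 with $W\neq\emptyset$ and $R\subseteq W\times W$. An $\mathbf{A}$-Kripke model is $\mathfrak{M}=\langle W,R,e\rangle$ with $\langle W,R\rangle$ a Kripke frame and $e:W\times\mathcal{V}\to A$, extended to formulas by interpreting propositional connectives and constants world-wise in $\mathbf{A}$ and $e(v,\Box\varphi)=\bigwedge_{Rvw}e(w,\varphi)$, $e(v,\Diamond\varphi)=\bigvee_{Rvw}e(w,\varphi)$. The model is safe if all these infima and suprema exist, for every formula and world. $\mathfrak{M}\models\varphi$ means $e(v,\varphi)=1$ for all $v\in W$; similarly for sets of formulas. For a class $\mathbb{C}$ of safe models and a finite set $\Gamma\cup\{\varphi\}$ of formulas, $\Gamma\vdash_{\mathbb{C}}\varphi$ (global consequence) means: for every $\mathfrak{M}\in\mathbb{C}$, $\mathfrak{M}\models\Gamma$ implies $\mathfrak{M}\models\varphi$. $K\mathbb{A}$ is the class of all safe $\mathbf{A}$-Kripke models with $\mathbf{A}\in\mathbb{A}$; $\omega K\mathbb{A}$ is the class of those with finite $W$. For a class of frames $\mathbb{F}$, $\vdash_{\mathbb{F}_{\mathbb{A}}}$ is the global consequence over all safe $\mathbf{A}$-Kripke models, $\mathbf{A}\in\mathbb{A}$, whose underlying frame is in $\mathbb{F}$. $\mathbb{L}$ is the class of all frames isomorphic to a finite chain $\langle\{1,\dots,k\},\{\langle i,i+1\rangle:1\le i<k\}\rangle$ for some $k\ge 1$. A logic $\vdash$ is decidable if the set of pairs $\langle\Gamma,\varphi\rangle$ with $\Gamma\cup\{\varphi\}$ a finite set of formulas and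 $\Gamma\vdash\varphi$ is decidable (recursive); otherwise it is undecidable. *)

(* Defs.v *)
From Stdlib Require Cantor List.
From HB Require Import structures.
From mathcomp Require Import all_boot all_order.
From mathcomp Require Import boolp classical_sets cardinality.

Set Implicit Arguments.
Unset Strict Implicit.
Unset Printing Implicit Defensive.

Local Open Scope classical_set_scope.
Local Open Scope group_scope.
Local Open Scope order_scope.

(* The bounds [0, 1] of the algebra are [\bot, \top]; integrality is
   [onegE], identifying the monoid unit with [\top]. *)
HB.mixin Record isFLew (d : Order.disp_t) T
    of Order.TBLattice d T & Monoid T := {
  fimp : T -> T -> T;
  fmulC : commutative (@mul T);
  onegE : (1%g : T) = \top;
  residuation : forall a b c : T, ((a * b)%g <= c) = (a <= fimp b c)
}.

#[short(type="flewType")]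
HB.structure Definition FLew d :=
  {T of Order.TBLattice d T & Monoid T & isFLew d T}.

Definition fneg d (B : flewType d) (a : B) : B := fimp a \bot.

Definition flew_chain d (B : flewType d) : Prop := total (<=%O : rel B).

Definition contractive n d (B : flewType d) : Prop :=
  forall a : B, (a ^+ n.+1)%g = (a ^+ n)%g.

Definition weakly_saturated d (B : flewType d) : Prop :=
  forall a b : B, (forall n, a <= (b ^+ n)%g) -> (a * b)%g = a.

Inductive formula : Type :=
| Var of nat
| And of formula & formula
| Or of formula & formula
| Mul of formula & formula
| Imp of formula & formula
| Neg of formula
| Zero
| One
| Box of formula
| Dia of formula.

Fixpoint over_vars (V : seq nat) (f : formula) : Prop :=
  match f with
  | Var i => i \in V
  | And g h | Or g h | Mul g h | Imp g h => over_vars V g /\ over_vars V h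
  | Neg g | Box g | Dia g => over_vars V g
  | Zero | One => True
  end.

Record frame : Type := Frame {
  world : Type;
  acc : world -> world -> Prop;
  world_inhabited : inhabited world
}.

Definition frame_iso (F G : frame) : Prop :=
  exists2 h : world F -> world G, bijective h &
    forall v w, acc v w <-> acc (h v) (h w).

(* The chain with [k.+1] worlds, numbered from 0. *)
Definition chain_frame (k : nat) : frame :=
  @Frame 'I_k.+1 (fun i j => j = i.+1 :> nat) (inhabits ord0).

Definition finite_chain_frames (F : frame) : Prop :=
  exists k, frame_iso F (chain_frame k).

Record kmodel (d : Order.disp_t) : Type := KModel {
  kalg : flewType d;
  kframe : frame;
  kval : world kframe -> nat -> kalg
}.

(* [value f v a]: the value of [f] at [v] is defined and equal to [a]. It may
   be undefined, since [kalg M] need not be complete; the value of a modal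
   formula at [v] requires that of its immediate subformula at every successor
   of [v]. *)
Fixpoint value d (M : kmodel d) (f : formula) (v : world (kframe M))
    (a : kalg M) {struct f} : Prop :=
  match f with
  | Var i => a = kval v i
  | And g h => exists b c, [/\ value g v b, value h v c & a = b `&` c]
  | Or g h => exists b c, [/\ value g v b, value h v c & a = b `|` c]
  | Mul g h => exists b c, [/\ value g v b, value h v c & a = (b * c)%g]
  | Imp g h => exists b c, [/\ value g v b, value h v c & a = fimp b c]
  | Neg g => exists2 b, value g v b & a = fneg b
  | Zero => a = \bot
  | One => a = \top
  | Box g => (forall w, acc v w -> exists b, value g w b) /\
             infimums [set b | exists2 w, acc v w & value g w b] a
  | Dia g => (forall w, acc v w -> exists b, value g w b) /\
             supremums [set b | exists2 w, acc v w & value g w b] a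
  end.

Definition safe d (M : kmodel d) : Prop :=
  forall f (v : world (kframe M)), exists a, value f v a.

Definition satisfies d (M : kmodel d) (f : formula) : Prop :=
  forall v : world (kframe M), value f v \top.

(* A finite set of premises is given by a list of its elements. *)
Definition logic : Type := seq formula -> formula -> Prop.

Definition consequence d (C : kmodel d -> Prop) : logic := fun Gamma f =>
  forall M, C M -> (forall g, List.In g Gamma -> satisfies M g) ->
    satisfies M f.

Definition K_models d (A : flewType d -> Prop) (M : kmodel d) : Prop :=
  A (kalg M) /\ safe M.

Definition finite_K_models d (A : flewType d -> Prop) (M : kmodel d) : Prop :=
  K_models A M /\ finite_set [set: world (kframe M)].

Definition frame_models d (F : frame -> Prop) (A : flewType d -> Prop)
    (M : kmodel d) : Prop :=
  K_models A M /\ F (kframe M).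

Definition fragment (V : seq nat) (L : logic) : logic := fun Gamma f =>
  [/\ forall g, List.In g Gamma -> over_vars V g, over_vars V f & L Gamma f].

(* Terms for the [n]-ary partial recursive functions. *)
Inductive murec : nat -> Type :=
| MZero : murec 0
| MSucc : murec 1
| MProj n (i : 'I_n) : murec n
| MComp m n (f : murec m) (g : 'I_m -> murec n) : murec n
| MPrec n (f : murec n) (g : murec n.+2) : murec n.+1
| MMin n (f : murec n.+1) : murec n.

(* [computes f x y]: the partial function [f] is defined at [x], with value [y].
   The recursion argument and the minimized argument come first. *)
Fixpoint computes n (f : murec n) : n.-tuple nat -> nat -> Prop :=
  match f in murec n return n.-tuple nat -> nat -> Prop with
  | MZero => fun _ y => y = 0%N
  | MSucc => fun x y => y = (thead x).+1
  | MProj _ i => fun x y => y = tnth x i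
  | MComp m _ f g => fun x y =>
      exists2 z : m.-tuple nat,
        forall i, computes (g i) x (tnth z i) & computes f z y
  | MPrec n f g => fun x y =>
      let k := thead x in
      let x' : n.-tuple nat := [tuple of behead x] in
      exists h : nat -> nat,
        [/\ computes f x' (h 0%N),
            forall i, (i < k)%N ->
              computes g [tuple of i :: h i :: x'] (h i.+1)
          & y = h k]
  | MMin _ f => fun x y =>
      computes f [tuple of y :: x] 0%N /\
      forall i, (i < y)%N -> exists z, computes f [tuple of i :: x] z.+1
  end.

Definition recursive (X : set nat) : Prop :=
  exists f : murec 1, forall n,
    (X n -> computes f [tuple n] 1%N) /\ (~ X n -> computes f [tuple n] 0%N).

Local Notation pair_code a b := (Cantor.to_nat (a%N, b%N)).

Fixpoint formula_code (f : formula) : nat :=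
  match f with
  | Var i => pair_code 0 i
  | And g h => pair_code 1 (pair_code (formula_code g) (formula_code h))
  | Or g h => pair_code 2 (pair_code (formula_code g) (formula_code h))
  | Mul g h => pair_code 3 (pair_code (formula_code g) (formula_code h))
  | Imp g h => pair_code 4 (pair_code (formula_code g) (formula_code h))
  | Neg g => pair_code 5 (formula_code g)
  | Zero => pair_code 6 0
  | One => pair_code 7 0
  | Box g => pair_code 8 (formula_code g)
  | Dia g => pair_code 9 (formula_code g)
  end.

Fixpoint formulas_code (Gamma : seq formula) : nat :=
  if Gamma is g :: Gamma' then
    (pair_code (formula_code g) (formulas_code Gamma')).+1
  else 0%N.

Definition decidable_logic (L : logic) : Prop :=
  recursive [set n | exists Gamma f,
    L Gamma f /\ n = pair_code (formulas_code Gamma) (formula_code f)].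

Definition undecidable_logic (L : logic) : Prop := ~ decidable_logic L.

(* Main.v *)
Require Import Defs.
From Stdlib Require Cantor List.
From mathcomp Require Import all_boot all_order.
From mathcomp Require Import zify.
From mathcomp Require Import boolp classical_sets cardinality.

(** Along a finite chain of worlds let [x = z ^ a] and [y = z ^ b]. Affine
    updates of [(a, b)] from the successor, and equality tests between powers
    of [z], are expressible, and [y], incremented at will, serves as a guessed
    quotient. Hence [a] can be rewritten by rules [D * j |-> E * j] with [j]
    coprime to [N], which simulate counter machines through prime exponents:
    the leaf carries the input [2 ^ n], the root an accepting number.

    All rules increase [a + b], so [x * y] decreases from each world to its
    predecessors by a factor at most [z]. On an infinite path the root value
    is below all powers of [z], weak saturation gives [x * y = x * y * z], and
    the goal [(x <-> y ^ K) -> (x * y -> x * y * z)] holds. On finite paths every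
    world carries powers of [z] that are distinct up to [a + b], and a failure
    of the goal forces the exact equality [a = K * b]. Conversely an accepting
    rewriting gives a finite chain model over an algebra that is not
    [(a + b)]-contractive.

    For undecidability, suppose that [f] decides the logic, and let the machine
    run [f] on the code of [start n :: Gamma |- goal], where [n] is both the
    input and the code of [Gamma]. Its own rules give a [Gamma], and for [n]
    the code of that [Gamma] the machine accepts iff the consequence holds,
    which is iff it does not accept. Compilation into rules thus need not be
    recursive, and since both answers of [f] halt, forward simulation of
    recursive functions is enough. *)

Set Implicit Arguments.
Unset Strict Implicit.
Unset Printing Implicit Defensive.

(** * Loop programs computing recursive functions *)

Definition env := nat -> nat.

Definition upd (s : env) (r v : nat) : env :=
  fun r' => if r' == r then v else s r'.

Inductive imp : Type :=
| Skip
| Inc of nat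
| Seq of imp & imp
| Loop of nat & imp.

(* [Loop r P] is [while r > 0 do (r := r - 1; P)]. *)
Inductive exec : imp -> env -> env -> Prop :=
| ExecSkip s : exec Skip s s
| ExecInc r s : exec (Inc r) s (upd s r (s r).+1)
| ExecSeq P Q s1 s2 s3 : exec P s1 s2 -> exec Q s2 s3 -> exec (Seq P Q) s1 s3
| ExecDone r P s : s r = 0 -> exec (Loop r P) s s
| ExecLoop r P s1 k s2 s3 : s1 r = k.+1 -> exec P (upd s1 r k) s2 ->
    exec (Loop r P) s2 s3 -> exec (Loop r P) s1 s3.

Ltac env_eq :=
  apply: funext => ?; rewrite /upd /=; repeat (case: eqP => ? //; subst => //); lia.

Lemma exec_eq P s1 s2 s3 : exec P s1 s2 -> s2 = s3 -> exec P s1 s3.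
Proof. by move=> ? <-. Qed.

Definition clear r := Loop r Skip.

Lemma exec_clear r s : exec (clear r) s (upd s r 0).
Proof.
move: {2}(s r) (erefl (s r)) => k; elim: k s => [|k IHk] s Hk.
  by apply: (exec_eq (ExecDone _ _)) => //; env_eq.
apply: (ExecLoop Hk (ExecSkip _)).
have := IHk (upd s r k); rewrite {1}/upd eqxx => /(_ erefl) /exec_eq; apply.
by env_eq.
Qed.

Definition move r r' := Loop r (Inc r').

Lemma exec_move r r' s : r != r' ->
  exec (move r r') s (upd (upd s r' (s r' + s r)) r 0).
Proof.
move=> ne; move: {2}(s r) (erefl (s r)) => k; elim: k s => [|k IHk] s Hk.
  by apply: (exec_eq (ExecDone _ _)) => //; env_eq.
apply: (ExecLoop Hk (ExecInc _ _)); apply: (exec_eq (IHk _ _)).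
  by rewrite /upd eqxx (negbTE ne).
by env_eq.
Qed.

Definition copy r o t := Seq (Loop r (Seq (Inc o) (Inc t))) (move t r).

Lemma exec_copy r o t s : r != o -> r != t -> o != t -> s t = 0 ->
  exec (copy r o t) s (upd s o (s o + s r)).
Proof.
move=> ro rt ot st.
have loop k s' : s' r = k -> exec (Loop r (Seq (Inc o) (Inc t))) s'
    (upd (upd (upd s' o (s' o + k)) t (s' t + k)) r 0).
  elim: k s' => [|k IHk] s' Hk.
    by apply: (exec_eq (ExecDone _ _)) => //; env_eq.
  apply: (ExecLoop Hk); first exact: ExecSeq (ExecInc _ _) (ExecInc _ _).
  apply: (exec_eq (IHk _ _)); last by env_eq.
  by rewrite /upd eqxx (negbTE ro) (negbTE rt).
apply: (ExecSeq (loop _ _ erefl)).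
apply: (exec_eq (exec_move _ _)); first by rewrite eq_sym.
by env_eq.
Qed.

Definition seqs (l : seq imp) : imp := foldr Seq Skip l.

(* The arguments are in the registers [ra], the result goes to [o], and all
   registers from [b] on are scratch, zero before and after the run. *)
Fixpoint loop_program n (f : murec n) (ra : seq nat) (o b : nat) : imp :=
  match f with
  | MZero => Skip
  | MSucc => Seq (copy (nth 0 ra 0) o b) (Inc o)
  | MProj _ i => copy (nth 0 ra i) o b
  | MComp m _ f g =>
      Seq (seqs [seq loop_program (g i) ra (b + i) (b + m) | i : 'I_m])
     (Seq (loop_program f (iota b m) o (b + m))
          (seqs [seq clear (b + i) | i : 'I_m]))
  | MPrec _ f g =>
      Seq (loop_program f (behead ra) b (b + 4))
     (Seq (copy (nth 0 ra 0) (b + 2) (b + 4))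
     (Seq (Loop (b + 2)
            (Seq (loop_program g [:: b + 1, b & behead ra] (b + 3) (b + 4))
            (Seq (clear b)
            (Seq (move (b + 3) b) (Inc (b + 1))))))
     (Seq (move b o) (clear (b + 1)))))
  | MMin _ f =>
      Seq (loop_program f (b :: ra) (b + 1) (b + 2))
     (Seq (Loop (b + 1)
            (Seq (clear (b + 1))
            (Seq (Inc b) (loop_program f (b :: ra) (b + 1) (b + 2)))))
          (move b o))
  end.

(** The output [o] has to start at zero because [copy] and [move] add to their target instead of
    overwriting it. *)
Definition ready (s : env) (ra : seq nat) (o b : nat) (x : seq nat) : Prop :=
  [/\ map s ra = x, all (fun r => r < b) ra, o \notin ra, o < b &
      forall r, r = o \/ b <= r -> s r = 0].

(** The final state differs from [s] at [o] alone: arguments and scratch registers are restored, so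
    programs can be chained and rerun inside loops. Nothing is claimed where [f] is undefined. *)
Definition compiled n (f : murec n) : Prop :=
  forall (x : n.-tuple nat) y, computes f x y -> forall s ra o b,
    ready s ra o b x -> exec (loop_program f ra o b) s (upd s o y).

Definition upds (s : env) (b : nat) (z : nat -> nat) (l : seq nat) : env :=
  fun r => if (b <= r) && (r - b \in l) then z (r - b) else s r.

(** Each program may rely only on its own target [b + i] and on the registers outside the block of
    [m] targets, so what its predecessors wrote is irrelevant to it. Composition uses this twice: to
    fill the block and to clear it. *)
Lemma exec_seqs (b : nat) (z : nat -> nat) m (P : 'I_m -> imp) s (l : seq 'I_m) :
  (forall (i : 'I_m) s', i \in l ->
     (forall r, r < b \/ r = b + i \/ b + m <= r -> s' r = s r) ->
     exec (P i) s' (upd s' (b + i) (z i))) -> uniq l ->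
  exec (seqs [seq P i | i <- l]) s (upds s b z [seq val i | i <- l]).
Proof.
elim: l s => [|i l IHl] s HP /=.
  move=> _; apply: (exec_eq (ExecSkip _)); apply: funext => r.
  by rewrite /upds in_nil andbF.
case/andP=> il ul; apply: ExecSeq.
  by apply: HP => //; rewrite mem_head.
apply: (exec_eq (IHl _ _ ul)).
  move=> j s' jl Hs'; apply: HP; first by rewrite inE jl orbT.
  move=> r Hr; rewrite Hs' // /upd; case: eqP => // er.
  have ij : i = j :> nat by have := ltn_ord i; lia.
  by rewrite (val_inj ij) jl in il.
apply: funext => r; rewrite /upds /upd inE.
case: (leqP b r) => br /=; last by case: eqP => // ?; lia.
have -> : (r == b + i) = (r - b == i) by lia.
by case: eqP => [->|_] /=; case: ifP.
Qed.

Lemma ready_sub s s' ra o b o' b' x : ready s ra o b x ->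
  (forall r, r < b -> r != o -> s' r = s r) -> o' < b' -> b <= b' ->
  o' \notin ra -> (forall r, r = o' \/ b' <= r -> s' r = 0) ->
  ready s' ra o' b' x.
Proof.
case=> sx rab ora ob so ss ob' bb' o'ra so'; split=> //.
  rewrite -sx; apply/eq_in_map => r rra; apply: ss; first exact: (allP rab).
  by apply: contraNneq ora => <-.
by apply/allP => r /(allP rab) /= rb; apply: leq_trans bb'.
Qed.

Lemma ready_notin s ra o b x r : ready s ra o b x -> b <= r -> r \notin ra.
Proof. by case=> _ /allP rab _ _ _ br; apply/negP => /rab /=; lia. Qed.

Lemma ready_nth s ra o b n (x : n.-tuple nat) (i : 'I_n) : ready s ra o b x ->
  [/\ s (nth 0 ra i) = tnth x i, nth 0 ra i < b & nth 0 ra i != o].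
Proof.
case=> sx rab ora ob so.
have sz : size ra = n by rewrite -(size_map s) sx size_tuple.
have ira : nth 0 ra i \in ra by rewrite mem_nth // sz.
split; last by apply: contraNneq ora => <-.
  by rewrite (tnth_nth 0) -sx (nth_map 0) ?sz.
exact: (allP rab).
Qed.

Lemma compiled_succ : compiled MSucc.
Proof.
move=> x y /= -> s ra o b R.
have [/= sx rb ro] := ready_nth ord0 R.
have [_ _ _ ob so] := R.
apply: ExecSeq; first by apply: exec_copy => //; try apply: so; try lia.
apply: (exec_eq (ExecInc _ _)); rewrite /thead -sx.
rewrite so; last by left.
by env_eq.
Qed.

Lemma compiled_proj n i : compiled (@MProj n i).
Proof.
move=> x y /= -> s ra o b R.
have [sx rb ro] := ready_nth i R.
have [_ _ _ ob so] := R.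
apply: exec_eq; first by apply: exec_copy => //; try apply: so; try lia.
by rewrite sx so //; left.
Qed.

Lemma compiled_comp m n (f : murec m) (g : 'I_m -> murec n) :
  compiled f -> (forall i, compiled (g i)) -> compiled (MComp f g).
Proof.
move=> Cf Cg x y /= [z Hg Hf] s ra o b R.
have [sx rab ora ob so] := R.
have vals (s' : env) (w : nat -> nat) : upds s' b w [seq val i | i <- enum 'I_m] =
    fun r => if (b <= r) && (r < b + m) then w (r - b) else s' r.
  apply: funext => r; rewrite /upds val_enum_ord mem_iota /=.
  by have -> : (b <= r) && (r - b < m) = (b <= r) && (r < b + m) by lia.
pose w i := nth 0 z i.
apply: (ExecSeq (s2 := upds s b w [seq val i | i <- enum 'I_m])).
  apply: (exec_seqs _ (enum_uniq _)) => i s' _ Hs'.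
  rewrite /w -tnth_nth; apply: Cg; first exact: Hg.
  have im := ltn_ord i.
  apply: (ready_sub R); try lia.
  - by move=> r rb ro; apply: Hs'; left.
  - by apply: (ready_notin R); lia.
  - move=> r [->|?]; rewrite Hs'; try lia; apply: so; lia.
apply: (ExecSeq (s2 := upd (upds s b w [seq val i | i <- enum 'I_m]) o y)).
  apply: (Cf _ _ Hf); rewrite vals; split.
  - apply: (@eq_from_nth _ 0); first by rewrite size_map size_iota size_tuple.
    rewrite size_map size_iota => i im.
    rewrite (nth_map 0) ?size_iota // nth_iota //.
    by rewrite leq_addr ltn_add2l im addKn.
  - by apply/allP => r /=; rewrite mem_iota; lia.
  - by rewrite mem_iota; lia.
  - lia.
  - by move=> r ?; case: ifP => ?; [lia | apply: so; lia].
apply: (exec_eq (exec_seqs (z := fun=> 0) _ (enum_uniq _))).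
  by move=> i s' _ _; apply: exec_clear.
rewrite !vals; apply: funext => r; rewrite /upd.
by case: ifP => br; case: eqP => // ?; rewrite ?br // ?so //; lia.
Qed.

Lemma compiled_prec n (f : murec n) (g : murec n.+2) :
  compiled f -> compiled g -> compiled (MPrec f g).
Proof.
move=> Cf Cg x y /= [h [Hf Hg ->]] s ra o b R.
have [sx rab ora ob so] := R.
have [/= rx rb ro] := ready_nth ord0 R.
rewrite /thead -{}rx /= in Hg *; set r0 := nth 0 ra 0 in rb ro Hg *.
set k := s r0.
have Rb : ready s (behead ra) o b (behead x).
  split=> //; first by rewrite -behead_map sx.
    by apply/allP => r /mem_behead /(allP rab).
  by apply: contraNN ora => /mem_behead.
(* State after [i] rounds: [b] holds the accumulated value, [b + 1] the index, [b + 2] the number of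
   rounds left. Register [b + 3] receives the next value and is emptied within the round. *)
pose st j i := upd (upd (upd s b j) (b + 1) i) (b + 2) (k - i).
apply: (ExecSeq (s2 := upd s b (h 0))).
  apply: (Cf _ _ Hf); apply: (ready_sub Rb) => //; try lia.
    by apply: (ready_notin Rb).
  by move=> r Hr; apply: so; lia.
apply: (ExecSeq (s2 := st (h 0) 0)).
  apply: exec_eq.
    apply: exec_copy; rewrite ?/upd; try lia.
    by rewrite so //; [case: eqP; lia | lia].
  have s1 : s (b + 1) = 0 by apply: so; lia.
  have s2 : s (b + 2) = 0 by apply: so; lia.
  rewrite /st -/r0 /k; env_eq.
apply: (ExecSeq (s2 := st (h k) k)).
  have Hloop i : i <= k -> exec (Loop (b + 2)
            (Seq (loop_program g [:: b + 1, b & behead ra] (b + 3) (b + 4))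
            (Seq (clear b)
            (Seq (move (b + 3) b) (Inc (b + 1)))))) (st (h (k - i)) (k - i)) (st (h k) k).
    elim: i => [|i IHi] ik.
      rewrite subn0; apply: ExecDone; rewrite /st /upd eqxx; lia.
    set s1 := upd (st (h (k - i.+1)) (k - i.+1)) (b + 2) i.
    have s1z r : b + 3 <= r -> s1 r = 0.
      move=> ?; rewrite /s1 /st /upd; repeat (case: eqP; first lia); move=> *.
      by apply: so; lia.
    apply: (ExecLoop (k := i)); first by rewrite /st /upd eqxx; lia.
      apply: (ExecSeq (s2 := upd s1 (b + 3) (h (k - i.+1).+1))).
        apply: (Cg _ _ (Hg (k - i.+1) _)); first lia.
        split; last by move=> r ?; apply: s1z; lia.
        - rewrite /=; congr [:: _, _ & _].
          + by rewrite /s1 /st /upd; repeat (case: eqP; try lia).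
          + by rewrite /s1 /st /upd; repeat (case: eqP; try lia).
          + rewrite -sx behead_map; apply/eq_in_map => r /mem_behead /(allP rab) /= rb'.
            by rewrite /s1 /st /upd; repeat (case: eqP; try lia).
        - rewrite /=; apply/and3P; split; try lia.
          by apply/allP => r /mem_behead /(allP rab) /=; lia.
        - rewrite !inE !negb_or; apply/and3P; split; try lia.
          by apply: (ready_notin Rb); lia.
        - lia.
      apply: ExecSeq; first exact: exec_clear.
      apply: ExecSeq; first by apply: exec_move; lia.
      exact: ExecInc.
    rewrite [X in exec _ X _](_ : _ = st (h (k - i)) (k - i)); first exact/IHi/ltnW.
    have s11 : s1 (b + 1) = k - i.+1.
      by rewrite /s1 /st /upd; repeat (case: eqP; try lia).
    rewrite (subnSK ik) /upd (s1z (b + 3)) //; apply: funext => r.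
    case: (ltnP r b) => rb'; first by rewrite /s1 /st /upd; repeat (case: eqP; try lia).
    have sr : s r = 0 by apply: so; right.
    rewrite s11 /s1 /st /upd sr; repeat (case: eqP; try lia).
  by have := Hloop k (leqnn _); rewrite subnn.
apply: ExecSeq; first by apply: exec_move; lia.
apply: (exec_eq (exec_clear _ _)).
have s1 : s (b + 1) = 0 by apply: so; lia.
have s2 : s (b + 2) = 0 by apply: so; lia.
have s0 : s b = 0 by apply: so; lia.
have so0 : s o = 0 by apply: so; lia.
rewrite /st; env_eq.
Qed.

Lemma compiled_min n (f : murec n.+1) : compiled f -> compiled (MMin f).
Proof.
move=> Cf x y /= [Hy Hlt] s ra o b R.
have [sx rab ora ob so] := R.
(* [b] holds the current candidate and [b + 1] the value of [f] there, which the loop tests. *)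
pose st i v := upd (upd s b i) (b + 1) v.
have sb : s b = 0 by apply: so; right.
have sb1 : s (b + 1) = 0 by apply: so; lia.
have so0 : s o = 0 by apply: so; left.
have run i v : computes f [tuple of i :: x] v ->
    exec (loop_program f (b :: ra) (b + 1) (b + 2)) (st i 0) (st i v).
  move=> Hv; apply: (exec_eq (Cf _ _ Hv _ _ _ _ _)); last by rewrite /st; env_eq.
  split; last by move=> r Hr; rewrite /st /upd; case: eqP => // ?;
    case: eqP => ?; try lia; apply: so; lia.
  - rewrite /= {1}/st /upd eqxx; case: eqP => [|_]; first lia.
    congr (_ :: _); rewrite -sx; apply/eq_in_map => r /(allP rab) /= rb.
    by rewrite /st /upd; repeat (case: eqP; try lia).
  - rewrite /=; apply/andP; split; first lia.
    by apply/allP => r /(allP rab) /=; lia.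
  - rewrite inE negb_or; apply/andP; split; first lia.
    by apply: (ready_notin R); lia.
  - lia.
(* Here [i] is the distance from the candidate to [y]; the value vanishes exactly at distance 0,
   where the loop stops. *)
have val i : i <= y -> exists2 v, computes f [tuple of y - i :: x] v &
    (i = 0 -> v = 0) /\ (0 < i -> 0 < v).
  case: (posnP i) => [-> _|ip iy]; first by exists 0; rewrite ?subn0.
  have [|z Hz] := Hlt (y - i); first lia.
  by exists z.+1; [|split => //; lia].
have Hloop i v : i <= y -> (i = 0 -> v = 0) -> (0 < i -> 0 < v) ->
    exec (Loop (b + 1)
      (Seq (clear (b + 1))
      (Seq (Inc b) (loop_program f (b :: ra) (b + 1) (b + 2))))) (st (y - i) v) (st y 0).
  elim: i v => [|i IHi] v iy v0 vp.
    by rewrite subn0 v0 //; apply: ExecDone; rewrite /st /upd eqxx.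
  case: v vp {v0} => [/(_ isT)//|v _].
  have [v' Hv' [v'0 v'p]] := val i (ltnW iy).
  apply: (ExecLoop (k := v)); first by rewrite /st /upd eqxx.
    apply: ExecSeq; first exact: exec_clear.
    apply: ExecSeq; first exact: ExecInc.
    have := run _ _ Hv'; congr (exec _ _ _).
    by rewrite /st -(subnSK iy); env_eq.
  by apply: IHi; [lia|..].
have [v Hv [v0 vp]] := val y (leqnn y).
apply: (ExecSeq (s2 := st 0 v)).
  rewrite subnn in Hv; have := run _ _ Hv.
  by rewrite (_ : st 0 0 = s) // /st; env_eq.
apply: (ExecSeq (s2 := st y 0)).
  by rewrite -[X in st X v](subnn y); apply: Hloop.
apply: (exec_eq (exec_move _ _)); first lia.
by rewrite /st; env_eq.
Qed.

Lemma loop_program_correct n (f : murec n) : compiled f.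
Proof.
elim: n / f => [||n i|m n f IHf g IHg|n f IHf g IHg|n f IHf].
- move=> x y /= -> s ra o b [_ _ _ _ so].
  by apply: (exec_eq (ExecSkip _)); have so0 := so _ (or_introl erefl); env_eq.
- exact: compiled_succ.
- exact: compiled_proj.
- exact: compiled_comp.
- exact: compiled_prec.
- exact: compiled_min.
Qed.

(** * Counter programs *)

Inductive instr : Type :=
| Incr of nat
| Jzdec of nat & nat
| Jmp of nat.

Definition step (C : seq instr) (c : nat * env) : option (nat * env) :=
  let: (l, s) := c in
  match onth C l with
  | Some (Incr r) => Some (l.+1, upd s r (s r).+1)
  | Some (Jzdec r l') =>
      Some (if s r is k.+1 then (l.+1, upd s r k) else (l', s))
  | Some (Jmp l') => Some (l', s)
  | None => None
  end.

Definition reaches (C : seq instr) (c c' : nat * env) : Prop :=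
  exists n, iter n (obind (step C)) (Some c) = Some c'.

Lemma reaches_refl C c : reaches C c c.
Proof. by exists 0. Qed.

Lemma reaches_step C c c1 c' : step C c = Some c1 -> reaches C c1 c' ->
  reaches C c c'.
Proof. by move=> E [n Hn]; exists n.+1; rewrite iterSr /= E. Qed.

Lemma reaches_rstep C c c1 c' : reaches C c c1 -> step C c1 = Some c' ->
  reaches C c c'.
Proof. by move=> [n Hn] E; exists n.+1; rewrite iterS Hn. Qed.

Lemma reaches_trans C c1 c2 c3 : reaches C c1 c2 -> reaches C c2 c3 ->
  reaches C c1 c3.
Proof. by move=> [m Hm] [n Hn]; exists (n + m); rewrite iterD Hm. Qed.

(** Since [step] is a function, one of two runs from the same configuration extends the other, and a
    halted configuration has no proper extension. *)
Lemma reaches_halt C c c1 c2 : reaches C c c1 -> step C c1 = None ->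
  reaches C c c2 -> step C c2 = None -> c1 = c2.
Proof.
have halt m c' c'' : step C c' = None ->
    iter m (obind (step C)) (Some c') = Some c'' -> c' = c''.
  case: m => [|m] E; first by case.
  rewrite iterSr /= E; have -> : iter m (obind (step C)) None = None by elim: m => //= m ->.
  by [].
move=> [m Hm] E1 [n Hn] E2.
case: (leqP m n) => [/subnK|/ltnW/subnK] e.
  by move: Hn; rewrite -e iterD Hm; apply: halt.
by move: Hm; rewrite -e iterD Hn => /(halt _ _ _ E2).
Qed.

(** [l] is the label of the first instruction, needed because jumps are absolute; a loop exits to
    the label just past its closing [Jmp]. *)
Fixpoint flat_code (P : imp) (l : nat) : seq instr :=
  match P with
  | Skip => [::]
  | Inc r => [:: Incr r]
  | Seq P Q => flat_code P l ++ flat_code Q (l + size (flat_code P l))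
  | Loop r P =>
      let C := flat_code P l.+1 in
      Jzdec r (l + (size C).+2) :: C ++ [:: Jmp l]
  end.

Lemma onth_cat_size T (L : seq T) i R : onth (L ++ i :: R) (size L) = Some i.
Proof. by elim: L. Qed.

Lemma flat_code_correct P s s' : exec P s s' -> forall L R,
  reaches (L ++ flat_code P (size L) ++ R) (size L, s)
    (size L + size (flat_code P (size L)), s').
Proof.
elim=> {P s s'} [s|r s|P Q s1 s2 s3 _ IHP _ IHQ|r P s s0|r P s1 k s2 s3 s1r _ IHP _ IHL] L R /=.
- by rewrite addn0; apply: reaches_refl.
- by apply: reaches_step (reaches_refl _ _); rewrite /= onth_cat_size addn1.
- set C := flat_code P (size L).
  apply: (reaches_trans (c2 := (size L + size C, s2))).
    by rewrite -catA; apply: IHP.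
  by have := IHQ (L ++ C) R; rewrite -!catA !size_cat addnA.
- apply: (reaches_step _ (reaches_refl _ _)).
  by rewrite /= onth_cat_size s0 size_cat /= addn1.
- have := IHL L R; rewrite /=; set C := flat_code P (size L).+1.
  set J := Jzdec _ _ => {}IHL.
  have E : L ++ (J :: C ++ [:: Jmp (size L)]) ++ R = rcons L J ++ C ++ Jmp (size L) :: R.
    by rewrite -cats1 -!catA /= -catA.
  apply: (reaches_step (c1 := ((size L).+1, upd s1 r k))).
    by rewrite /= onth_cat_size /J s1r.
  move: IHL; rewrite E => IHL; apply: (reaches_trans (c2 := ((size L).+1 + size C, s2))).
    by have := IHP (rcons L J) (Jmp (size L) :: R); rewrite size_rcons.
  apply: (reaches_step _ IHL).
  have -> : (size L).+1 + size C = size (rcons L J ++ C) by rewrite size_cat size_rcons.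
  by rewrite catA /= onth_cat_size.
Qed.

(** * Guarded multiplication rules *)

Definition rule : Type := (nat * nat * nat)%type.

(** For counters stored as prime exponents, [D] decrements, [E] increments, and coprimality of [j]
    to [N] is a zero test. *)
Definition rstep (R : seq rule) (a a' : nat) : Prop :=
  exists D E N j, [/\ (D, E, N) \in R, coprime j N, a = D * j & a' = E * j].

Inductive rreach (R : seq rule) (a0 : nat) : nat -> Prop :=
| RRefl : rreach R a0 a0
| RStep a a' : rreach R a0 a -> rstep R a a' -> rreach R a0 a'.

(** [D < E] makes every rewriting of a positive number increase it; [1 < N] excludes 0 as a residue
    coprime to [N]. *)
Definition growing (R : seq rule) : Prop :=
  forall D E N, (D, E, N) \in R -> D < E /\ 1 < N.

(** * Counter configurations as prime exponents *)

Lemma prime_sequence : exists p : nat -> nat,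
  [/\ p 0 = 2, injective p & forall i, prime (p i)].
Proof.
pose p := fix p i := if i is i'.+1 then pdiv (p i')`!.+1 else 2.
have pr i : prime (p i).
  by case: i => [//|i]; apply: pdiv_prime; rewrite ltnS fact_gt0.
have ltS i : p i < p i.+1.
  rewrite ltnNge /= -/p; apply/negP => le; set q := pdiv _ in le.
  have qp : prime q by apply: pdiv_prime; rewrite ltnS fact_gt0.
  have qf : q %| (p i)`! by rewrite dvdn_fact // prime_gt0.
  have : q %| (p i)`!.+1 by apply: pdiv_dvd.
  by rewrite -addn1 dvdn_addr // dvdn1 => /eqP q1; rewrite q1 in qp.
have mono i j : i < j -> p i < p j.
  elim: j => [//|j IHj]; rewrite ltnS leq_eqVlt => /orP[/eqP->|/IHj lt].
    exact: ltS.
  exact: ltn_trans lt (ltS j).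
exists p; split=> // i j e.
by case: (ltngtP i j) => // /mono; rewrite e ltnn.
Qed.

Definition pp : nat -> nat := projT1 (cid prime_sequence).

Lemma pp0 : pp 0 = 2. Proof. by rewrite /pp; case: cid => p []. Qed.

Lemma pp_inj : injective pp.
Proof. by rewrite /pp; case: cid => p []. Qed.

Lemma pp_prime i : prime (pp i).
Proof. by rewrite /pp; case: cid => p []. Qed.

Lemma logn_pp i j : logn (pp i) (pp j) = (i == j).
Proof. by rewrite logn_prime ?pp_prime // (inj_eq pp_inj). Qed.

Lemma pp_gt0 i : 0 < pp i.
Proof. exact/prime_gt0/pp_prime. Qed.

Lemma coprime_pp j i : 0 < j -> coprime j (pp i) = (logn (pp i) j == 0).
Proof.
move=> j0; rewrite coprime_sym prime_coprime ?pp_prime //.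
by rewrite lognE pp_prime j0 /=; case: ifP.
Qed.

(* Registers skip three primes: the exponent of [pp 1] is the label of the
   current instruction, [pp 2] flags acceptance, and powers of [pp 3] make
   every rule increasing. Register 0 keeps [pp 0 = 2], so that the input [n] is
   encoded by [2 ^ n]. *)
Definition rp (r : nat) : nat := if r is r'.+1 then r'.+4 else 0.

Lemma rp_inj : injective rp.
Proof. by case=> [|i] [|j] //= [->]. Qed.

(** The factor [pp 3 ^ D] exceeds [D], so any positive [E] gives an increasing rule, and [pp 3]
    stores neither the label nor a register. *)
Definition mk (D E : nat) (N : nat) : rule := (D, pp 3 ^ D * E, N).

(** Coprimality to [pp 1] makes a rule for label [l] applicable at exponent exactly [l], not at
    every larger label. The second rule for [Jzdec] tests its register for zero in the same way. *)
Definition instr_rules (l : nat) (i : instr) : seq rule :=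
  match i with
  | Incr r => [:: mk (pp 1 ^ l) (pp 1 ^ l.+1 * pp (rp r)) (pp 1)]
  | Jzdec r l' =>
      [:: mk (pp 1 ^ l * pp (rp r)) (pp 1 ^ l.+1) (pp 1);
          mk (pp 1 ^ l) (pp 1 ^ l') (pp 1 * pp (rp r))]
  | Jmp l' => [:: mk (pp 1 ^ l) (pp 1 ^ l') (pp 1)]
  end.

Definition accept_rule (l o : nat) : rule :=
  mk (pp 1 ^ l * pp (rp o)) (pp 2 * pp 1 ^ l.+1) (pp 1).

Definition rules (C : seq instr) (o : nat) : seq rule :=
  accept_rule (size C) o ::
  flatten [seq instr_rules l (nth (Jmp 0) C l) | l <- iota 0 (size C)].

(** The exponent of [pp 3] is left free, so a configuration has many codes; exponent 0 at [pp 2]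
    says that acceptance has not been flagged. *)
Definition represents (a : nat) (c : nat * env) : Prop :=
  [/\ 0 < a, logn (pp 1) a = c.1, logn (pp 2) a = 0 &
      forall r, logn (pp (rp r)) a = c.2 r].

Lemma rulesP C o D E N : (D, E, N) \in rules C o ->
  (D, E, N) = accept_rule (size C) o \/
  exists2 l, l < size C & (D, E, N) \in instr_rules l (nth (Jmp 0) C l).
Proof.
rewrite inE => /orP[/eqP->|/flattenP[s /mapP[l]]]; first by left.
by rewrite mem_iota /= => lC -> H; right; exists l.
Qed.

Lemma growing_rules C o : growing (rules C o).
Proof.
have mkP D E N : 0 < E -> 1 < N -> D < (mk D E N).1.2 /\ 1 < N.
  move=> E0 N1; split=> //=; apply: (@leq_trans (pp 3 ^ D)).
    exact/ltn_expl/prime_gt1/pp_prime.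
  by rewrite leq_pmulr.
have p1 i : 1 < pp i by apply/prime_gt1/pp_prime.
move=> D E N /rulesP[[-> -> ->]|[l _]].
  by apply: (mkP); rewrite ?muln_gt0 ?expn_gt0 ?pp_gt0.
case: (nth _ _ _) => [r|r l'|l'] /=; rewrite !inE; do ?[case/orP];
  move=> /eqP[-> -> ->]; apply: (mkP); rewrite ?muln_gt0 ?expn_gt0 ?pp_gt0 //.
by rewrite (leq_trans (p1 1)) // leq_pmulr // pp_gt0.
Qed.

Lemma represents_mul D E j l s c :
  represents (D * j) (l, s) -> 0 < E -> coprime j (pp 1) ->
  logn (pp 1) E = c.1 -> logn (pp 2) E = 0 ->
  (forall r, logn (pp (rp r)) E + s r = logn (pp (rp r)) D + c.2 r) ->
  represents (pp 3 ^ D * E * j) c.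
Proof.
case=> /=; rewrite muln_gt0 => /andP[D0 j0] H1 H2 Hr E0 cj E1 E2 Er.
rewrite coprime_pp // in cj; move/eqP in cj.
have r3 r : (rp r == 3) = false by case: r => [|[|[]]].
split.
- by rewrite !muln_gt0 expn_gt0 pp_gt0 E0.
- by rewrite !lognM ?lognX ?logn_pp /= ?muln0 ?muln_gt0 ?expn_gt0 ?pp_gt0 ?E0 // cj E1 addn0.
- move: H2; rewrite !lognM ?lognX ?logn_pp /= ?muln0 ?muln_gt0 ?expn_gt0 ?pp_gt0 ?E0 //.
  by rewrite E2; lia.
- move=> r; have := Hr r; have := Er r.
  rewrite !lognM ?lognX ?logn_pp ?r3 /= ?muln0 ?muln_gt0 ?expn_gt0 ?pp_gt0 ?E0 // add0n => e1 e2.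
  by apply: (@addnI (logn (pp (rp r)) D)); rewrite -e1 -e2 addnCA.
Qed.

Lemma onth_nth T (d : T) (s : seq T) l : l < size s -> onth s l = Some (nth d s l).
Proof. by elim: s l => [|x s IHs] [|l] //= /IHs. Qed.

Lemma rp1 r : (rp r == 1) = false. Proof. by case: r. Qed.

Lemma rp2 r : (rp r == 2) = false. Proof. by case: r => [|[]]. Qed.

Lemma rp1' r : (1 == rp r) = false. Proof. by rewrite eq_sym rp1. Qed.

Lemma rp2' r : (2 == rp r) = false. Proof. by rewrite eq_sym rp2. Qed.

Definition ppE := (lognX, logn_pp, eqxx, rp1, rp2, rp1', rp2',
  muln1, muln0, addn0, add0n, muln_gt0, expn_gt0, pp_gt0, inj_eq rp_inj).

(** Any applicable rule is the one of the current instruction, since coprimality to [pp 1] fixes the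
    label and, for [Jzdec], divisibility or coprimality decides the test. Only the accept rule leads
    to the second alternative. *)
Lemma represents_step C o a c a' : represents a c -> rstep (rules C o) a a' ->
  (exists2 c', step C c = Some c' & represents a' c') \/
  c.1 = size C /\ 0 < c.2 o.
Proof.
case: c => l s ra [D [E [N [j [Hin cj ea ea']]]]]; subst a a'.
have [a0 al _ ar] := ra; rewrite /= in al ar.
have [D0 j0] : 0 < D /\ 0 < j by move: a0; rewrite muln_gt0 => /andP.
have lab k m : coprime j (pp 1) -> 0 < m -> logn (pp 1) m = 0 ->
    D = pp 1 ^ k * m -> l = k.
  move=> cj1 m0 m1 eD; rewrite -al eD !lognM ?ppE ?m0 // m1.
  by rewrite coprime_pp // in cj1; rewrite (eqP cj1) !ppE.
have [[eD eE eN]|[k kC]] := rulesP Hin.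
  right; rewrite eN in cj; rewrite (lab _ _ cj _ _ eD) ?ppE //; split=> //=.
  by rewrite -ar eD !lognM ?ppE ?eqxx.
move: (onth_nth (Jmp 0) kC); case: (nth _ _ _) => [r|r l'|l'] eC H; left; move: H; rewrite !inE.
- move=> /eqP[eD eE eN]; rewrite eN in cj.
  have lk : l = k by apply: (lab _ 1 cj); rewrite ?logn1 ?muln1.
  rewrite lk in ra *; exists (k.+1, upd s r (s r).+1); first by rewrite /= eC.
  rewrite eE; rewrite eD in ra; apply: (represents_mul ra);
    [by rewrite ?ppE|exact: cj|by rewrite ?lognM ?ppE|by rewrite ?lognM ?ppE|].
  by move=> r'; rewrite !lognM ?ppE // /upd /=; case: eqP => [->|_].
- case/orP=> /eqP[eD eE eN]; rewrite eN in cj.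
    have lk : l = k by apply: (lab _ _ cj _ _ eD); rewrite ?ppE.
    have : 0 < s r by rewrite -ar eD !lognM ?ppE ?eqxx.
    case sr: (s r) => [//|v] _.
    rewrite lk in ra *; exists (k.+1, upd s r v); first by rewrite /= eC sr.
    rewrite eE; rewrite eD in ra; apply: (represents_mul ra);
    [by rewrite ?ppE|exact: cj|by rewrite ?lognM ?ppE|by rewrite ?lognM ?ppE|].
    by move=> r'; rewrite !lognM ?ppE // /upd /=; case: eqP => [->|_]; lia.
  move: cj; rewrite coprimeMr => /andP[cj cjr].
  have lk : l = k by apply: (lab _ 1 cj); rewrite ?logn1 ?muln1.
  have sr : s r = 0.
    by rewrite -ar eD !lognM ?ppE //; apply/eqP; rewrite -coprime_pp.
  rewrite lk in ra *; exists (l', s); first by rewrite /= eC sr.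
  rewrite eE; rewrite eD in ra; apply: (represents_mul ra);
    [by rewrite ?ppE|exact: cj|by rewrite ?lognM ?ppE|by rewrite ?lognM ?ppE|].
  by move=> r'; rewrite ?lognM ?ppE.
- move=> /eqP[eD eE eN]; rewrite eN in cj.
  have lk : l = k by apply: (lab _ 1 cj); rewrite ?logn1 ?muln1.
  rewrite lk in ra *; exists (l', s); first by rewrite /= eC.
  rewrite eE; rewrite eD in ra; apply: (represents_mul ra);
    [by rewrite ?ppE|exact: cj|by rewrite ?lognM ?ppE|by rewrite ?lognM ?ppE|].
  by move=> r'; rewrite ?lognM ?ppE.
Qed.

Lemma represents_split a l s : represents a (l, s) ->
  exists2 j, a = pp 1 ^ l * j & coprime j (pp 1).
Proof.
case=> a0 /= al _ _; have [j cj ea] := pfactor_coprime (pp_prime 1) a0.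
by exists j; rewrite 1?coprime_sym // mulnC -al.
Qed.

Lemma represents_splitr a l s r : represents a (l, s) -> 0 < s r ->
  exists2 j, a = pp 1 ^ l * pp (rp r) * j & coprime j (pp 1).
Proof.
move=> ra sr; have [j ea cj] := represents_split ra; case: ra => a0 _ _ /= ar.
have j0 : 0 < j by move: a0; rewrite ea muln_gt0 => /andP[].
have /dvdnP[j' ej] : pp (rp r) %| j.
  rewrite -[pp _]expn1 pfactor_dvdn ?pp_prime //.
  by move: sr; rewrite -ar ea lognM ?ppE.
exists j'; first by rewrite ea ej -mulnA (mulnC j').
by move: cj; rewrite ej coprimeMl => /andP[].
Qed.

Lemma onth_size T (s : seq T) l x : onth s l = Some x -> l < size s.
Proof. by elim: s l => [|y s IHs] [|l] //= /IHs. Qed.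

Lemma instr_rules_sub C o l i : onth C l = Some i ->
  {subset instr_rules l i <= rules C o}.
Proof.
move=> eC q qi; have lC := onth_size eC.
rewrite inE; apply/orP; right; apply/flattenP; exists (instr_rules l i) => //.
apply/mapP; exists l; rewrite ?mem_iota //.
by have := onth_nth (Jmp 0) lC; rewrite eC => -[<-].
Qed.

Lemma rstep_mk R D E N j : mk D E N \in R -> coprime j N ->
  rstep R (D * j) (pp 3 ^ D * E * j).
Proof. by move=> HR cj; exists D, (pp 3 ^ D * E), N, j. Qed.

Lemma step_represents C o a c c' : represents a c -> step C c = Some c' ->
  exists2 a', rstep (rules C o) a a' & represents a' c'.
Proof.
case: c => l s ra Hs.
(* Some applicable rule suffices: by [represents_step] and determinism its result represents [c'],
   as the accept rule would need a halted configuration. *)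
suff [a' Ha'] : exists a', rstep (rules C o) a a'.
  exists a' => //; have [[c'']|[/= el _]] := represents_step ra Ha'.
    by rewrite Hs => -[->].
  by move: Hs; rewrite /= el; case eC: (onth _ _) => [i|//]; have := onth_size eC; rewrite ltnn.
move: Hs; rewrite /=; case eC: (onth _ _) => [i|//] _.
have sub := instr_rules_sub o eC.
have [j ea cj] := represents_split ra.
case: i eC sub => [r|r l'|l'] eC sub.
- by eexists; rewrite ea; apply: rstep_mk cj; apply: sub; apply: mem_head.
- have [sr|sr] := posnP (s r); last first.
    have [j' -> cj'] := represents_splitr ra sr.
    by eexists; apply: rstep_mk cj'; apply: sub; apply: mem_head.
  eexists; rewrite ea; apply: (rstep_mk (N := pp 1 * pp (rp r))).
    by apply: sub; rewrite in_cons; apply/orP; right; apply: mem_head.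
  case: ra => a0 _ _ /(_ r) /= ar.
  have j0 : 0 < j by move: a0; rewrite ea muln_gt0 => /andP[].
  rewrite coprimeMr cj coprime_pp //=.
  by move: ar; rewrite ea lognM ?ppE // sr => ->.
- by eexists; rewrite ea; apply: rstep_mk cj; apply: sub; apply: mem_head.
Qed.

Lemma accept_represents C o a s : represents a (size C, s) -> 0 < s o ->
  exists2 a', rstep (rules C o) a a' & pp 2 %| a'.
Proof.
move=> ra so; have [j -> cj] := represents_splitr ra so.
eexists; first by apply: rstep_mk cj; apply: mem_head.
by rewrite -mulnA dvdn_mull // -mulnA dvdn_mulr.
Qed.

Definition init (n : nat) : nat * env := (0, upd (fun=> 0) 0 n).

Lemma represents_init n : represents (2 ^ n) (init n).
Proof.
rewrite -pp0; split; rewrite ?ppE //= => r.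
by rewrite !ppE /upd; case: r => [|r] /=; rewrite ?muln1 ?muln0.
Qed.

Lemma rreach_accept C o n :
  (exists2 a, rreach (rules C o) (2 ^ n) a & pp 2 %| a) <->
  exists2 s, reaches C (init n) (size C, s) & 0 < s o.
Proof.
split=> [[a Ha Ka]|[s Hs so]].
  (* Until the accept rule is first used, the number represents a reached configuration, and then
     [pp 2] does not divide it. *)
  suff [[c _ [a0 _ a2 _]]|//] : (exists2 c, reaches C (init n) c & represents a c) \/
      exists2 s, reaches C (init n) (size C, s) & 0 < s o.
    by move: Ka; rewrite -[pp 2]expn1 pfactor_dvdn ?pp_prime // a2.
  elim: Ha {Ka} => [|{}a a' _ [[c Hc rc]|]]; last by right.
    by left; exists (init n); [apply: reaches_refl | apply: represents_init].
  move=> /(represents_step rc)[[c' Hc' rc']|[ec so]].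
    by left; exists c' => //; apply: reaches_rstep Hc Hc'.
  by right; exists c.2 => //; rewrite -ec -surjective_pairing.
have sim c : reaches C (init n) c ->
    exists2 a, rreach (rules C o) (2 ^ n) a & represents a c.
  case=> k; elim: k c => [|k IHk] c /=.
    by case=> <-; exists (2 ^ n); [apply: RRefl | apply: represents_init].
  case E: (iter _ _ _) => [c'|//] /= Hc.
  have [a Ha rc'] := IHk _ E.
  have [a' Ha' rc] := step_represents o rc' Hc.
  by exists a' => //; apply: RStep Ha Ha'.
have [a Ha ra] := sim _ Hs.
have [a' Ha' Ka] := accept_represents ra so.
by exists a' => //; apply: RStep Ha Ha'.
Qed.

(** * Recursiveness of the diagonal code *)

Definition mrec n (F : n.-tuple nat -> nat) : Prop :=
  exists f : murec n, forall x, computes f x (F x).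

Lemma mrec_ext n (F G : n.-tuple nat -> nat) : F =1 G -> mrec F -> mrec G.
Proof. by move=> FG [f Hf]; exists f => x; rewrite -FG. Qed.

Lemma mrec_comp m n (F : m.-tuple nat -> nat) (G : 'I_m -> n.-tuple nat -> nat) :
  mrec F -> (forall i, mrec (G i)) -> mrec (fun x => F [tuple G i x | i < m]).
Proof.
move=> [f Hf] /choice[g Hg]; exists (MComp f g) => x.
by exists [tuple G i x | i < m] => // i; rewrite tnth_mktuple.
Qed.

Lemma mrec_proj n (i : 'I_n) : mrec (fun x => tnth x i).
Proof. by exists (MProj i). Qed.

Definition mrec1 (F : nat -> nat) : Prop := mrec (fun x : 1.-tuple nat => F (thead x)).

Definition mrec2 (F : nat -> nat -> nat) : Prop :=
  mrec (fun x : 2.-tuple nat => F (tnth x ord0) (tnth x ord_max)).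

Lemma mrec_comp1 n F (G : n.-tuple nat -> nat) : mrec1 F -> mrec G ->
  mrec (fun x => F (G x)).
Proof.
move=> HF HG; have := mrec_comp HF (fun=> HG); apply: mrec_ext => x.
by rewrite /thead tnth_mktuple.
Qed.

Lemma mrec_comp2 n F (G1 G2 : n.-tuple nat -> nat) : mrec2 F -> mrec G1 -> mrec G2 ->
  mrec (fun x => F (G1 x) (G2 x)).
Proof.
move=> HF H1 H2.
have HG (i : 'I_2) : mrec (if i == ord0 then G1 else G2) by case: ifP.
have := mrec_comp HF HG; apply: mrec_ext => x.
by rewrite !tnth_mktuple.
Qed.

Lemma mrec1_succ : mrec1 succn.
Proof. by exists MSucc. Qed.

Lemma mrec_const n c : mrec (fun _ : n.-tuple nat => c).
Proof.
elim: c => [|c IHc]; last exact: mrec_comp1 mrec1_succ IHc.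
have H0 : mrec (fun _ : 0.-tuple nat => 0) by exists MZero.
by have := mrec_comp (n := n) (G := fun _ _ => 0) H0; apply=> -[].
Qed.

Lemma mrec_prec n (F : n.-tuple nat -> nat) (G : n.+2.-tuple nat -> nat) :
  mrec F -> mrec G ->
  mrec (fun x : n.+1.-tuple nat => nat_rect (fun=> nat) (F [tuple of behead x])
    (fun i h => G [tuple of i :: h :: behead x]) (thead x)).
Proof.
move=> [f Hf] [g Hg]; exists (MPrec f g) => x /=.
exists (nat_rect (fun=> nat) (F [tuple of behead x])
  (fun i h => G [tuple of i :: h :: behead x])).
by split=> [|i _|]; [apply: Hf | apply: Hg | ].
Qed.

Lemma mrec1_prec c G : mrec2 G -> mrec1 (nat_rect (fun=> nat) c G).
Proof.
move=> HG; have := mrec_prec (mrec_const 0 c) HG; apply: mrec_ext => x.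
by elim: (thead x) => //= i ->; rewrite !(tnth_nth 0).
Qed.

Lemma mrec2_add : mrec2 addn.
Proof.
have := mrec_prec (mrec_proj (@ord0 0)) (mrec_comp1 mrec1_succ (mrec_proj (Ordinal (isT : 1 < 3)))).
apply: mrec_ext => x; rewrite /thead; elim: (tnth x ord0) => [|i IHi] /=.
  by rewrite !(tnth_nth 0) /= nth_behead.
by rewrite addSn -IHi !(tnth_nth 0).
Qed.

Lemma mrec2_pair : mrec2 (fun a b => Cantor.to_nat (a, b)).
Proof.
(* [Cantor.to_nat (a, b)] is [b] plus the triangular number of [b + a], which this recursion
   computes. *)
have tri : mrec1 (nat_rect (fun=> nat) 0 (fun i m => i.+1 + m)).
  apply: mrec1_prec; apply: mrec_comp2 mrec2_add _ (mrec_proj _).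
  exact: mrec_comp1 mrec1_succ (mrec_proj _).
have := mrec_comp2 mrec2_add (mrec_proj (@ord_max 1))
  (mrec_comp1 tri (mrec_comp2 mrec2_add (mrec_proj (@ord_max 1)) (mrec_proj (@ord0 1)))).
exact: mrec_ext.
Qed.

Lemma mrec_pair n (F G : n.-tuple nat -> nat) : mrec F -> mrec G ->
  mrec (fun x => Cantor.to_nat (F x, G x)).
Proof. exact: mrec_comp2 mrec2_pair. Qed.

(** * Evaluation in safe models *)

Import Order.TTheory.
Local Open Scope order_scope.

Lemma fmul_le2r d (B : flewType d) (a b c : B) : a <= b -> (a * c)%g <= (b * c)%g.
Proof.
by move=> ab; rewrite residuation; apply: le_trans ab _; rewrite -residuation.
Qed.

Lemma fmul_le2l d (B : flewType d) (a b c : B) : a <= b -> (c * a)%g <= (c * b)%g.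
Proof. by rewrite !(fmulC c); apply: fmul_le2r. Qed.

Lemma fmul_lel d (B : flewType d) (a b : B) : (a * b)%g <= a.
Proof. by rewrite -[leRHS]mulg1; apply: fmul_le2l; rewrite onegE lex1. Qed.

Lemma fimp_top d (B : flewType d) (a b : B) : (fimp a b = \top) <-> (a <= b).
Proof.
have -> : (a <= b) = ((1 * a)%g <= b) by rewrite mul1g.
by rewrite residuation onegE le1x; split=> [->|/eqP].
Qed.

Lemma fexpg_anti d (B : flewType d) (a : B) m n : (m <= n)%N -> (a ^+ n)%g <= (a ^+ m)%g.
Proof. by move=> /subnK <-; rewrite addnC expgnDr fmul_lel. Qed.

(* Multiplying by [a ^+ (m - i)] pushes the collapse [t * a ^+ i <= a ^+ i.+1]
   down to the exponent [m]. *)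
Lemma fexpg_neq d (B : flewType d) (a t : B) i j m : i <> j -> (i <= m)%N ->
  (a ^+ i * t)%g <= (a ^+ j)%g -> (a ^+ j * t)%g <= (a ^+ i)%g ->
  (a ^+ m * t)%g <= (a ^+ m.+1)%g.
Proof.
have low k l : (k < l)%N -> (k <= m)%N -> (a ^+ k * t)%g <= (a ^+ l)%g ->
    (a ^+ m * t)%g <= (a ^+ m.+1)%g.
  move=> kl km H.
  have {}H : (a ^+ k * t)%g <= (a ^+ k.+1)%g := le_trans H (fexpg_anti _ kl).
  rewrite -(subnK km) -addnS !expgnDr -mulgA; exact: fmul_le2l.
move=> ij im H1 H2; case: (ssrnat.ltngtP i j) => // lt.
  exact: low lt im H1.
by apply: (low _ _ lt _ H2); lia.
Qed.

Lemma value_fun d (M : kmodel d) f (v : world (kframe M)) a b :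
  value f v a -> value f v b -> a = b.
Proof.
elim: f v a b => [i|g IHg h IHh|g IHg h IHh|g IHg h IHh|g IHg h IHh|g IHg|||g IHg|g IHg] v a b /=.
- by move=> -> ->.
- by move=> [a1 [a2 [A1 A2 ->]]] [b1 [b2 [B1 B2 ->]]]; rewrite (IHg _ _ _ A1 B1) (IHh _ _ _ A2 B2).
- by move=> [a1 [a2 [A1 A2 ->]]] [b1 [b2 [B1 B2 ->]]]; rewrite (IHg _ _ _ A1 B1) (IHh _ _ _ A2 B2).
- by move=> [a1 [a2 [A1 A2 ->]]] [b1 [b2 [B1 B2 ->]]]; rewrite (IHg _ _ _ A1 B1) (IHh _ _ _ A2 B2).
- by move=> [a1 [a2 [A1 A2 ->]]] [b1 [b2 [B1 B2 ->]]]; rewrite (IHg _ _ _ A1 B1) (IHh _ _ _ A2 B2).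
- by move=> [a1 A1 ->] [b1 B1 ->]; rewrite (IHg _ _ _ A1 B1).
- by move=> -> ->.
- by move=> -> ->.
- by move=> [_ A] [_ B]; apply: is_subset1_infimums A B.
- by move=> [_ A] [_ B]; apply: is_subset1_supremums A B.
Qed.

Definition ev d (M : kmodel d) (S : safe M) (f : formula) (v : world (kframe M)) : kalg M :=
  projT1 (cid (S f v)).

Lemma evP d (M : kmodel d) (S : safe M) f v : value f v (ev S f v).
Proof. exact: projT2 (cid (S f v)). Qed.

Lemma evE d (M : kmodel d) (S : safe M) f v a : value f v a -> ev S f v = a.
Proof. exact/value_fun/evP. Qed.

Lemma satisfiesE d (M : kmodel d) (S : safe M) f :
  satisfies M f <-> forall v, ev S f v = \top.
Proof.
by split=> [H v|H v]; [apply: evE | rewrite /= -(H v); apply: evP].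
Qed.

Lemma ev_var d (M : kmodel d) (S : safe M) i v : ev S (Var i) v = kval v i.
Proof. exact: evE. Qed.

Lemma ev_and d (M : kmodel d) (S : safe M) f g v : ev S (And f g) v = ev S f v `&` ev S g v.
Proof. by apply: evE; do 2!eexists; split; try exact: evP. Qed.

Lemma ev_or d (M : kmodel d) (S : safe M) f g v : ev S (Or f g) v = ev S f v `|` ev S g v.
Proof. by apply: evE; do 2!eexists; split; try exact: evP. Qed.

Lemma ev_mul d (M : kmodel d) (S : safe M) f g v : ev S (Mul f g) v = (ev S f v * ev S g v)%g.
Proof. by apply: evE; do 2!eexists; split; try exact: evP. Qed.

Lemma ev_imp d (M : kmodel d) (S : safe M) f g v : ev S (Imp f g) v = fimp (ev S f v) (ev S g v).
Proof. by apply: evE; do 2!eexists; split; try exact: evP. Qed.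

Lemma ev_neg d (M : kmodel d) (S : safe M) f v : ev S (Neg f) v = fneg (ev S f v).
Proof. by apply: evE; eexists; try exact: evP. Qed.

Lemma ev_zero d (M : kmodel d) (S : safe M) v : ev S Zero v = \bot.
Proof. exact: evE. Qed.

Lemma ev_one d (M : kmodel d) (S : safe M) v : ev S One v = \top.
Proof. exact: evE. Qed.

Lemma ev_box_le d (M : kmodel d) (S : safe M) f v w : acc v w -> ev S (Box f) v <= ev S f w.
Proof. by move=> vw; have [_ [lb _]] := evP S (Box f) v; apply: lb; exists w; last exact: evP. Qed.

Lemma le_ev_box d (M : kmodel d) (S : safe M) f v a :
  (forall w, acc v w -> a <= ev S f w) -> a <= ev S (Box f) v.
Proof.
move=> H; have [_ [_ ub]] := evP S (Box f) v; apply: ub => b [w vw /(evE S) <-].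
exact: H.
Qed.

Lemma le_ev_dia d (M : kmodel d) (S : safe M) f v w : acc v w -> ev S f w <= ev S (Dia f) v.
Proof. by move=> vw; have [_ [ub _]] := evP S (Dia f) v; apply: ub; exists w; last exact: evP. Qed.

Lemma ev_dia_le d (M : kmodel d) (S : safe M) f v a :
  (forall w, acc v w -> ev S f w <= a) -> ev S (Dia f) v <= a.
Proof.
move=> H; have [_ [_ lb]] := evP S (Dia f) v; apply: lb => b [w vw /(evE S) <-].
exact: H.
Qed.

(** By integrality, the meet of the two implications has value [\top] exactly when their product
    does. *)
Definition feq f g := And (Imp f g) (Imp g f).

Definition fpow f n := iter n (Mul f) One.

Lemma meet_top d (B : flewType d) (a b : B) : a `&` b = \top <-> a = \top /\ b = \top.
Proof.
split=> [H|[-> ->]]; last by rewrite meet1x.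
by split; apply/eqP; rewrite -le1x -H ?leIl ?leIr.
Qed.

Lemma ev_feq d (M : kmodel d) (S : safe M) f g v :
  ev S (feq f g) v = \top <-> ev S f v = ev S g v.
Proof.
rewrite ev_and !ev_imp meet_top !fimp_top.
split=> [[ab ba]|->]; last by [].
by apply/eqP; rewrite eq_le ab ba.
Qed.

Lemma ev_fpow d (M : kmodel d) (S : safe M) f n v : ev S (fpow f n) v = (ev S f v ^+ n)%g.
Proof.
elim: n => [|n IHn]; first by rewrite ev_one expg0 onegE.
by rewrite /fpow iterS -/(fpow f n) ev_mul IHn expgS.
Qed.

(** [Box Zero] is [\top] at a world without successors, as an empty infimum, and [\bot] elsewhere;
    hence it and its negation act as classical guards of implications. *)
Definition nonleaf := Neg (Box Zero).

Lemma ev_box_leaf d (M : kmodel d) (S : safe M) f v : (forall w, ~ acc v w) ->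
  ev S (Box f) v = \top.
Proof. by move=> H; apply/eqP; rewrite -le1x; apply: le_ev_box => w /H. Qed.

Lemma ev_box_zero d (M : kmodel d) (S : safe M) v w : acc v w -> ev S (Box Zero) v = \bot.
Proof. by move=> vw; apply/eqP; rewrite -lex0 -(ev_zero S w) ev_box_le. Qed.

Lemma sat_nonleaf d (M : kmodel d) (S : safe M) f v :
  ev S (Imp nonleaf f) v = \top <-> ((exists w, acc v w) -> ev S f v = \top).
Proof.
rewrite ev_imp fimp_top ev_neg /fneg.
case: (pselect (exists w, acc v w)) => [[w vw]|nw].
  rewrite (ev_box_zero S vw).
  have -> : fimp \bot \bot = \top :> kalg M by apply/fimp_top.
  rewrite le1x; split=> [/eqP //|H].
  by apply/eqP/H; exists w.
split=> [_ /nw //|_].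
rewrite ev_box_leaf => [|w vw]; last by apply: nw; exists w.
apply: le_trans (le0x _); by rewrite -[leLHS]mulg1 onegE residuation.
Qed.

Lemma sat_leaf d (M : kmodel d) (S : safe M) f v :
  ev S (Imp (Box Zero) f) v = \top <-> ((forall w, ~ acc v w) -> ev S f v = \top).
Proof.
rewrite ev_imp fimp_top.
case: (pselect (exists w, acc v w)) => [[w vw]|nw].
  by rewrite (ev_box_zero S vw) le0x; split=> // _ /(_ w).
have {}nw : forall w, ~ acc v w by move=> w vw; apply: nw; exists w.
by rewrite ev_box_leaf // le1x; split=> [/eqP //|/(_ nw) ->].
Qed.

Lemma sat_or d (M : kmodel d) (S : safe M) f g v : flew_chain (kalg M) ->
  ev S (Or f g) v = \top <-> ev S f v = \top \/ ev S g v = \top.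
Proof.
move=> ch; rewrite ev_or; split=> [|[->|->]]; rewrite ?join1x ?joinx1 //.
by case/orP: (ch (ev S f v) (ev S g v)) => [/join_r|/join_l] ->; [right|left].
Qed.

Lemma sat_foldr_or d (M : kmodel d) (S : safe M) f (l : seq formula) v : flew_chain (kalg M) ->
  ev S (foldr Or f l) v = \top <->
  ev S f v = \top \/ exists2 g, List.In g l & ev S g v = \top.
Proof.
move=> ch; elim: l => [|g l IHl] /=; first by split=> [|[//|[]//]]; left.
rewrite sat_or // IHl; split=> [[H|[H|[h hl H]]]|[H|[h [<-|hl] H]]].
- by right; exists g => //; left.
- by left.
- by right; exists h => //; right.
- by right; left.
- by left.
- by right; right; exists h.
Qed.

(** * From models to rewriting *)

(** Equality of infimum and supremum forces one common value of [p] at all successors, so a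
    branching model behaves like a chain. *)
Definition fixes p := Imp nonleaf (feq (Box p) (Dia p)).

Section Encoding.

Variables x y z : nat.

Let X := Var x.
Let Y := Var y.
Let Z := Var z.

(** If the successors carry [y = z ^ b], then for [j = N * b + s] the two products are [z ^ (D * j)]
    and [z ^ (E * j)]. Thus [b] is the guessed quotient of [j] by [N] and [s] its residue; the last
    conjunct resets [b] to 0. *)
Definition apply_formula (D E N s : nat) : formula :=
  And (feq (Box X) (Mul (fpow (Box Y) (D * N)) (fpow Z (D * s))))
      (And (feq X (Mul (fpow (Box Y) (E * N)) (fpow Z (E * s)))) Y).

Definition wait_formula : formula := And (feq X (Box X)) (feq Y (Mul (Box Y) Z)).

Definition rule_formulas (q : rule) : seq formula :=
  let: (D, E, N) := q in
  [seq apply_formula D E N s | s <- iota 0 N & coprime s N].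

Definition step_formula (R : seq rule) : formula :=
  foldr Or wait_formula (flatten [seq rule_formulas q | q <- R]).

Definition theory (R : seq rule) : seq formula :=
  [:: fixes X; fixes Y; fixes Z; Imp nonleaf (feq Z (Box Z));
      Imp (Box Zero) Y; Imp nonleaf (step_formula R)].

(** Iterated squaring yields [z ^ (2 ^ n)] with a formula whose code is obtained from [n] by a
    simple recursion. *)
Definition start (n : nat) : formula :=
  Imp (Box Zero) (feq X (iter n (fun f => Mul f f) Z)).

Definition goal (K : nat) : formula :=
  Imp (feq X (fpow Y K)) (Imp (Mul X Y) (Mul (Mul X Y) Z)).

End Encoding.

Lemma In_mem (T : eqType) (s : seq T) a : List.In a s <-> a \in s.
Proof.
elim: s => //= b s IHs; rewrite inE; split.
  by case=> [->|/IHs ->]; rewrite ?eqxx ?orbT.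
by case/orP=> [/eqP ->|/IHs]; [left | right].
Qed.

Lemma In_rule_formulas x y z (R : seq rule) g :
  List.In g (flatten [seq rule_formulas x y z q | q <- R]) <->
  exists D E N s, [/\ (D, E, N) \in R, (s < N)%N, coprime s N &
    g = apply_formula x y z D E N s].
Proof.
elim: R => [|[[D E] N] R IHR] /=; first by split=> // -[? [? [? [? []]]]].
rewrite List.in_app_iff List.in_map_iff IHR; split.
  case=> [[s [<- /In_mem]]|[D' [E' [N' [s [HR sN cs ->]]]]]].
    rewrite mem_filter mem_iota => /andP[cs /andP[_ sN]].
    by exists D, E, N, s; rewrite mem_head.
  by exists D', E', N', s; rewrite in_cons HR orbT.
case=> [D' [E' [N' [s [HR sN cs ->]]]]].
move: HR; rewrite in_cons => /orP[/eqP[eD eE eN]|HR]; last first.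
  by right; exists D', E', N', s.
left; exists s; split; first by rewrite eD eE eN.
by apply/In_mem; rewrite mem_filter mem_iota -eN cs.
Qed.

Lemma ev_iter_sqr d (M : kmodel d) (S : safe M) f n v :
  ev S (iter n (fun f => Mul f f) f) v = (ev S f v ^+ (2 ^ n))%g.
Proof.
elim: n => [|n IHn]; first by rewrite expg1.
by rewrite iterS ev_mul IHn -expgnDr expnS mul2n addnn.
Qed.

Lemma sat_step d (M : kmodel d) (S : safe M) x y z R v : flew_chain (kalg M) ->
  ev S (step_formula x y z R) v = \top <->
  (ev S (Var x) v = ev S (Box (Var x)) v /\
   ev S (Var y) v = (ev S (Box (Var y)) v * ev S (Var z) v)%g) \/
  exists D E N s, [/\ (D, E, N) \in R, (s < N)%N, coprime s N &
   [/\ ev S (Box (Var x)) v = (ev S (Box (Var y)) v ^+ (D * N) * ev S (Var z) v ^+ (D * s))%g,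
       ev S (Var x) v = (ev S (Box (Var y)) v ^+ (E * N) * ev S (Var z) v ^+ (E * s))%g &
       ev S (Var y) v = \top]].
Proof.
have applyE D E N s : ev S (apply_formula x y z D E N s) v = \top <->
    [/\ ev S (Box (Var x)) v = (ev S (Box (Var y)) v ^+ (D * N) * ev S (Var z) v ^+ (D * s))%g,
       ev S (Var x) v = (ev S (Box (Var y)) v ^+ (E * N) * ev S (Var z) v ^+ (E * s))%g &
       ev S (Var y) v = \top].
  rewrite ev_and meet_top ev_feq ev_and meet_top ev_feq !ev_mul !ev_fpow.
  by split=> [[? [? ?]]|[? ? ?]].
move=> ch; rewrite sat_foldr_or // ev_and meet_top !ev_feq ev_mul.
split=> -[H|H]; try by left.
  case: H => g /In_rule_formulas[D [E [N [s [HR sN cs ->]]]]] /applyE H.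
  by right; exists D, E, N, s.
case: H => [D [E [N [s [HR sN cs /applyE H]]]]].
by right; exists (apply_formula x y z D E N s) => //; apply/In_rule_formulas; exists D, E, N, s.
Qed.

Lemma fixesP d (M : kmodel d) (S : safe M) p v w : ev S (fixes p) v = \top ->
  acc v w -> ev S p w = ev S (Box p) v.
Proof.
move=> /sat_nonleaf H vw; apply/eqP; rewrite eq_le ev_box_le // andbT.
have /ev_feq -> : ev S (feq (Box p) (Dia p)) v = \top by apply: H; exists w.
exact: le_ev_dia.
Qed.

Lemma fmulACA d (B : flewType d) (a b c e : B) :
  (a * b * (c * e))%g = (a * c * (b * e))%g.
Proof. by rewrite !mulgA -(mulgA a) (fmulC b) mulgA. Qed.

Lemma theory_sound d (M : kmodel d) (S : safe M) x y z R n K :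
  flew_chain (kalg M) -> weakly_saturated (kalg M) -> growing R ->
  (forall g, List.In g (start x z n :: theory x y z R) -> satisfies M g) ->
  ~ satisfies M (goal x y z K) ->
  exists2 a, rreach R (2 ^ n) a & (K %| a)%N.
Proof.
move=> ch ws gR Hth.
have sat g v : List.In g (start x z n :: theory x y z R) -> ev S g v = \top.
  by move=> /Hth /(satisfiesE S).
rewrite (satisfiesE S) => /existsNP[v0].
rewrite ev_imp fimp_top; set t := ev S (feq _ _) v0.
rewrite ev_imp -residuation !ev_mul.
set c := ev S (Var z) v0.
pose P v := (ev S (Var x) v * ev S (Var y) v)%g.
pose good v := exists a b, [/\ rreach R (2 ^ n) a, ev S (Var x) v = (c ^+ a)%g &
  ev S (Var y) v = (c ^+ b)%g].
rewrite -/(P v0) => Ht.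
have HP : ~ P v0 <= (P v0 * c)%g.
  by move=> le; apply: Ht; rewrite fmulC; apply: le_trans le; apply: fmul_lel.
(* Along an edge from [v] to [w], strictness of [P] passes down to [w], [P v] picks up a factor [c],
   and goodness passes back up to [v]. *)
have step v w : ev S (Var z) v = c -> ~ P v <= (P v * c)%g -> acc v w ->
    [/\ ev S (Var z) w = c, ~ P w <= (P w * c)%g, P v <= (P w * c)%g & good w -> good v].
  move=> zv Pv vw; have exw : exists w, acc v w by exists w.
  have fx := fixesP (sat (fixes (Var x)) v _) vw.
  have fy := fixesP (sat (fixes (Var y)) v _) vw.
  have fz := fixesP (sat (fixes (Var z)) v _) vw.
  move: fx fy fz; set bx := ev S (Box (Var x)) v; set b_y := ev S (Box (Var y)) v.
  move=> /(_ (or_intror (or_introl erefl))) fx.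
  move=> /(_ (or_intror (or_intror (or_introl erefl)))) fy.
  move=> /(_ (or_intror (or_intror (or_intror (or_introl erefl))))) fz.
  have zw : ev S (Var z) w = c.
    rewrite fz -zv; apply/esym/ev_feq; have /sat_nonleaf : ev S (Imp nonleaf (feq (Var z) (Box (Var z)))) v = \top.
      by apply: sat; do 4!right; left.
    exact.
  have Pw : P w = (bx * b_y)%g by rewrite /P fx fy.
  have : ev S (step_formula x y z R) v = \top.
    have /sat_nonleaf : ev S (Imp nonleaf (step_formula x y z R)) v = \top.
      by apply: sat; do 6!right; left.
    exact.
  move=> /(sat_step S x y z R v ch); rewrite -/bx -/b_y zv => Hstep.
  have [u Pu] : exists u, P v = (P w * (u * c))%g.
    rewrite Pw /P; case: Hstep => [[-> ->]|[D [E [N [s [HR sN cs [-> -> ->]]]]]]].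
      by exists 1%g; rewrite mul1g mulgA.
    have [DE N1] := gR _ _ _ HR.
    have s0 : (0 < s)%N by case: s cs {sN} => //; rewrite /coprime gcd0n; case: N N1 {HR} => [|[]].
    (* The surplus exponents are [p.+1] and [q.+1]: one factor [b_y] completes [P w = bx * b_y], and
       one factor [c] is the required gain. *)
    pose p := (E * N - D * N).-1; pose q := (E * s - D * s).-1.
    have eN : (E * N = D * N + p.+1)%N.
      by have := DE; rewrite -(ltn_pmul2r (ltnW N1)) /p; lia.
    have es : (E * s = D * s + q.+1)%N.
      by have := DE; rewrite -(ltn_pmul2r s0) /q; lia.
    exists (b_y ^+ p * c ^+ q)%g.
    rewrite eN es -onegE mulg1 (expgnDr b_y) (expgnDr c) [LHS]fmulACA.
    by rewrite (expgS b_y) (expgSr c) !mulgA.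
  have Pwc : ~ P w <= (P w * c)%g.
    move=> le; apply: Pv; rewrite Pu.
    have -> : (P w * (u * c) * c)%g = (P w * c * (u * c))%g.
      by rewrite -[LHS]mulgA (fmulC (u * c)%g) mulgA.
    exact: fmul_le2r.
  split=> //.
  - by rewrite Pu; apply: fmul_le2l; rewrite fmulC fmul_lel.
  - rewrite /good => -[a [b [Ha]]]; rewrite fx fy => ea eb.
    case: Hstep => [[-> ->]|[D [E [N [s [HR sN cs [ebx -> ->]]]]]]].
      by exists a, b.+1; rewrite ea eb expgSr.
    exists (E * (N * b + s)), 0; split.
    + apply: RStep Ha _; exists D, E, N, (N * b + s); split=> //.
        by rewrite -coprime_modl mulnC modnMDl coprime_modl.
      have ea' : (c ^+ a)%g = (c ^+ (D * (N * b + s)))%g.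
        rewrite -ea ebx eb -!expgnA -expgnDr; congr (_ ^+ _)%g; lia.
      (* Equal powers of [c] with distinct exponents would collapse all powers from [c ^ a] on, in
         particular at [P w = c ^ (a + b)]. *)
      apply: contrapT => ne; apply: Pwc.
      rewrite Pw ea eb -expgnDr -expgSr -[leLHS]mulg1.
      by apply: (fexpg_neq ne (leq_addr _ _)); rewrite mulg1 ea'.
    + by rewrite eb -!expgnA -expgnDr; congr (_ ^+ _)%g; lia.
    + by rewrite expg0 onegE.
(* At a good [v0], [t] lies below both implications between [c ^ a] and [c ^ (b * K)]. If [a]
   differed from [b * K], [fexpg_neq] would yield the inequality that [Ht] refutes. *)
have [[a [b [Ha xa yb]]]|bad] := pselect (good v0).
  exists a => //; apply/dvdnP; exists b; apply: contrapT => ne; apply: Ht.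
  have : t <= fimp (ev S (Var x) v0) (ev S (fpow (Var y) K) v0) by rewrite /t ev_and !ev_imp leIl.
  have : t <= fimp (ev S (fpow (Var y) K) v0) (ev S (Var x) v0) by rewrite /t ev_and !ev_imp leIr.
  rewrite -!residuation ev_fpow yb xa -expgnA /P xa yb -expgnDr -expgSr.
  rewrite !(fmulC t) => h2 h1; apply: fexpg_neq h1 h2; first lia.
  exact: leq_addr.
exfalso.
have leafgood v : (forall w, ~ acc v w) -> ev S (Var z) v = c -> good v.
  move=> nw zv; exists (2 ^ n), 0; split; first exact: RRefl.
    have /sat_leaf /(_ nw) /ev_feq : ev S (start x z n) v = \top by apply: sat; left.
    by rewrite ev_iter_sqr zv.
  have /sat_leaf /(_ nw) -> : ev S (Imp (Box Zero) (Var y)) v = \top.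
    by apply: sat; do 5!right; left.
  by rewrite expg0 onegE.
(* A world that is not good has a successor, by [leafgood], and no good one, so the descent never
   ends; each edge adds a factor [c] to the bound. *)
have Hinf k v : ev S (Var z) v = c -> ~ P v <= (P v * c)%g -> ~ good v ->
    P v <= (c ^+ k)%g.
  elim: k v => [|k IHk] v zv Pv nv; first by rewrite expg0 onegE lex1.
  have [w vw] : exists w, acc v w.
    by apply: contrapT => nw; apply: nv; apply: leafgood => // w vw; apply: nw; exists w.
  have [zw Pw le gw] := step v w zv Pv vw.
  apply: le_trans le _; rewrite expgSr; apply: fmul_le2r; apply: IHk => //.
  by move/gw.
have := ws (P v0) c (fun k => Hinf k v0 erefl HP bad).
by move=> e; apply: HP; rewrite e.
Qed.

(** * From rewriting to models *)

Definition chain_model d (B : flewType d) k (val : 'I_k.+1 -> nat -> B) : kmodel d :=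
  @KModel d B (chain_frame k) val.

Lemma chain_succ k (v w w' : world (chain_frame k)) : acc v w -> acc v w' -> w' = w.
Proof. by move=> /= vw vw'; apply: val_inj; rewrite /= vw vw'. Qed.

(** Worlds of a chain have at most one successor, so the infima and suprema range over a singleton
    or the empty set and exist in any bounded lattice. *)
Lemma chain_safe d (B : flewType d) k (val : 'I_k.+1 -> nat -> B) :
  safe (chain_model val).
Proof.
elim=> [i|g IHg h IHh|g IHg h IHh|g IHg h IHh|g IHg h IHh|g IHg|||g IHg|g IHg] v /=.
- by eexists.
- have [a Ha] := IHg v; have [b Hb] := IHh v; by eexists; exists a, b.
- have [a Ha] := IHg v; have [b Hb] := IHh v; by eexists; exists a, b.
- have [a Ha] := IHg v; have [b Hb] := IHh v; by eexists; exists a, b.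
- have [a Ha] := IHg v; have [b Hb] := IHh v; by eexists; exists a, b.
- by have [a Ha] := IHg v; eexists; exists a.
- by eexists.
- by eexists.
- case: (pselect (exists w : world (chain_frame k), acc v w)) => [[w vw]|nw].
    have [a Ha] := IHg w; exists a; split=> [w' _|]; first exact: IHg.
    rewrite (_ : mkset _ = [set a]%classic) ?infimums1 // predeqE => b.
    split=> [[w' /(chain_succ vw) ->]|->]; last by exists w.
    by move=> Hb; apply: value_fun Hb Ha.
  exists \top; split=> [w vw|]; first by case: nw; exists w.
  split=> [b [w vw]|b _]; first by case: nw; exists w.
  exact: lex1.
- case: (pselect (exists w : world (chain_frame k), acc v w)) => [[w vw]|nw].
    have [a Ha] := IHg w; exists a; split=> [w' _|]; first exact: IHg.
    rewrite (_ : mkset _ = [set a]%classic) ?supremums1 // predeqE => b.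
    split=> [[w' /(chain_succ vw) ->]|->]; last by exists w.
    by move=> Hb; apply: value_fun Hb Ha.
  exists \bot; split=> [w vw|]; first by case: nw; exists w.
  split=> [b [w vw]|b _]; first by case: nw; exists w.
  exact: le0x.
Qed.

(** The effect on exponents of [wait_formula] and [apply_formula], read from a successor [c] to its
    predecessor [c']. Paths are indexed from the root, so they step from [i.+1] to [i]. *)
Definition pstep (R : seq rule) (c c' : nat * nat) : Prop :=
  c'.1 = c.1 /\ c'.2 = c.2.+1 \/
  exists D E N s, [/\ (D, E, N) \in R, (s < N)%N, coprime s N &
    [/\ c.1 = D * (N * c.2 + s), c'.1 = E * (N * c.2 + s) & c'.2 = 0%N]].

Definition has_path (R : seq rule) (a0 : nat) (c : nat * nat) : Prop :=
  exists k (p : nat -> nat * nat),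
    [/\ p 0%N = c, p k = (a0, 0%N) & forall i, (i < k)%N -> pstep R (p i.+1) (p i)].

Lemma has_path_step R a0 c c' : has_path R a0 c -> pstep R c c' -> has_path R a0 c'.
Proof.
move=> [k [p [p0 pk Hp]]] cc'.
exists k.+1, (fun i => if i is j.+1 then p j else c'); split=> //.
by case=> [_|i]; [rewrite p0 | apply: Hp].
Qed.

(** To apply a rule with cofactor [j], first wait until the second component equals [j %/ N], then
    use the residue [j %% N]; further waiting produces the desired [b]. *)
Lemma rreach_path R a0 a b : rreach R a0 a -> growing R -> has_path R a0 (a, b).
Proof.
move=> Ha gR; have wait a1 : has_path R a0 (a1, 0%N) -> forall b, has_path R a0 (a1, b).
  by move=> H0; elim=> // b' /has_path_step; apply; left.
apply: (wait); elim: Ha => {a} [|a a' _ IHa [D [E [N [j [HR cj ea ->]]]]]].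
  by exists 0, (fun=> (a0, 0%N)).
have [_ N1] := gR _ _ _ HR.
apply: has_path_step (wait _ IHa (j %/ N)) _; right; exists D, E, N, (j %% N).
by rewrite /= (mulnC N) -divn_eq ltn_mod coprime_modl (ltnW N1).
Qed.

Lemma theory_complete (x y z : nat) R n K a : uniq [:: x; y; z] ->
  growing R -> rreach R (2 ^ n) a -> (K %| a)%N ->
  exists m, forall d (B : flewType d), flew_chain B -> ~ contractive m B ->
  exists k (val : 'I_k.+1 -> nat -> B),
    (forall g, List.In g (start x z n :: theory x y z R) ->
       satisfies (chain_model val) g) /\
    ~ satisfies (chain_model val) (goal x y z K).
Proof.
(* At the root [x * y] is [c ^ (a + b)], so the goal fails there once [c] witnesses that [B] is not
   [(a + b)]-contractive. *)
move=> uxyz gR Ha /dvdnP[b eab]; exists (a + b)%N => d B ch /existsNP[c Hc].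
have [k [p [p0 pk Hp]]] := rreach_path b Ha gR.
pose val (i : 'I_k.+1) j := if j == x then (c ^+ (p i).1)%g
  else if j == y then (c ^+ (p i).2)%g else c.
exists k, val; set M := chain_model val; pose S : safe M := @chain_safe d B k val.
move: uxyz; rewrite /= !inE andbT negb_or => /andP[/andP[xy xz] yz].
have vx (v : world (kframe M)) : ev S (Var x) v = (c ^+ (p (v : 'I_k.+1)).1)%g.
  by rewrite ev_var /= /val eqxx.
have vy (v : world (kframe M)) : ev S (Var y) v = (c ^+ (p (v : 'I_k.+1)).2)%g.
  by rewrite ev_var /= /val eq_sym (negbTE xy) eqxx.
have vz (v : world (kframe M)) : ev S (Var z) v = c.
  by rewrite ev_var /= /val eq_sym (negbTE xz) eq_sym (negbTE yz).
have box f (v w : world (kframe M)) : acc v w -> ev S (Box f) v = ev S f w.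
  move=> vw; apply/eqP; rewrite eq_le ev_box_le //=; apply: le_ev_box => w'.
  by move=> /(chain_succ vw) ->.
have dia f (v w : world (kframe M)) : acc v w -> ev S (Dia f) v = ev S f w.
  move=> vw; apply/eqP; rewrite eq_le le_ev_dia // andbT; apply: ev_dia_le => w'.
  by move=> /(chain_succ vw) ->.
split; last first.
  rewrite (satisfiesE S) => /(_ (ord0 : 'I_k.+1)).
  rewrite ev_imp (_ : ev S (feq _ _) _ = \top); last first.
    by apply/ev_feq; rewrite ev_fpow vx vy p0 /= eab expgnA.
  rewrite fimp_top le1x => /eqP; rewrite ev_imp fimp_top !ev_mul vx vy vz p0 /=.
  rewrite -expgnDr -expgSr => le; apply: Hc; apply/eqP.
  by rewrite eq_le le fexpg_anti.
move=> g Hg; apply/(satisfiesE S) => v.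
have fixed q : ev S (fixes q) v = \top.
  apply/sat_nonleaf => -[w vw]; apply/ev_feq.
  by rewrite (box _ _ _ vw) (dia _ _ _ vw).
have leaf : (forall w, ~ acc v w) -> (v : 'I_k.+1) = k :> nat.
  move=> nw; apply/eqP; rewrite eqn_leq -ltnS ltn_ord /= leqNgt; apply/negP => vk.
  by apply: (nw (Ordinal (vk : (v : 'I_k.+1).+1 < k.+1)%N)).
case: Hg => [<-|[<-|[<-|[<-|[<-|[<-|[<-|[]]]]]]]] //.
- apply/sat_leaf => /leaf vk; apply/ev_feq.
  by rewrite vx ev_iter_sqr vz vk pk.
- by apply/sat_nonleaf => -[w vw]; apply/ev_feq; rewrite (box _ _ _ vw) !vz.
- by apply/sat_leaf => /leaf vk; rewrite vy vk pk expg0 onegE.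
apply/sat_nonleaf => -[w vw]; apply/sat_step => //.
rewrite !(box _ _ _ vw) !vx !vy !vz.
have vk : ((v : 'I_k.+1) < k)%N by rewrite -ltnS -[X in (X < _)%N]vw ltn_ord.
have -> : (w : 'I_k.+1) = (v : 'I_k.+1).+1 :> nat by [].
case: (Hp _ vk) => [[-> ->]|[D [E [N [s [HR sN cs [-> -> ->]]]]]]].
  by left; rewrite expgSr.
right; exists D, E, N, s; split=> //; rewrite -!expgnA -!expgnDr expg0 onegE.
by split=> //; congr (_ ^+ _)%g; lia.
Qed.

(** * Diagonalisation *)

Local Close Scope order_scope.

Lemma to_nat_pair_inj a b a' b' : Cantor.to_nat (a, b) = Cantor.to_nat (a', b') ->
  a = a' /\ b = b'.
Proof. by move=> /Cantor.to_nat_inj[-> ->]. Qed.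

Lemma formula_code_inj : injective formula_code.
Proof.
elim=> [i|g IHg h IHh|g IHg h IHh|g IHg h IHh|g IHg h IHh|g IHg|||g IHg|g IHg];
  case=> [i'|g' h'|g' h'|g' h'|g' h'|g'|||g'|g'] /to_nat_pair_inj [] // _ E.
- by rewrite E.
- by have [/IHg -> /IHh ->] := to_nat_pair_inj E.
- by have [/IHg -> /IHh ->] := to_nat_pair_inj E.
- by have [/IHg -> /IHh ->] := to_nat_pair_inj E.
- by have [/IHg -> /IHh ->] := to_nat_pair_inj E.
- by rewrite (IHg _ E).
- by rewrite (IHg _ E).
- by rewrite (IHg _ E).
Qed.

Lemma formulas_code_inj : injective formulas_code.
Proof.
elim=> [|g l IHl] [|g' l'] // E.
by have [/formula_code_inj -> /IHl ->] := to_nat_pair_inj (succn_inj E).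
Qed.

(* The code of the consequence [start x z n :: Gamma |- goal x y z K], as a
   function of [n], where [n] is moreover the code of [Gamma]. *)
Definition diagonal_code (x y z K n : nat) : nat :=
  Cantor.to_nat ((Cantor.to_nat (formula_code (start x z n), n)).+1,
    formula_code (goal x y z K)).

Lemma mrec_diagonal_code x y z K : mrec1 (diagonal_code x y z K).
Proof.
pose sq := nat_rect (fun=> nat) (formula_code (Var z))
  (fun _ h => Cantor.to_nat (3, Cantor.to_nat (h, h))).
have sqE n : formula_code (iter n (fun f => Mul f f) (Var z)) = sq n.
  by elim: n => // n IHn; rewrite iterS [LHS]/= IHn.
have Hsq : mrec1 sq.
  apply: mrec1_prec; apply: mrec_pair (mrec_const _ _) _.
  by apply: mrec_pair; apply: mrec_proj.
apply: mrec_pair (mrec_const _ _); apply: (mrec_comp1 mrec1_succ).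
apply: mrec_pair (mrec_proj ord0).
pose c := formula_code (Var x).
(* The code of [start x z n] unfolded, with tags 4 for [Imp] and 1 for [And]. *)
apply: (@mrec_ext _ (fun t => Cantor.to_nat (4, Cantor.to_nat (formula_code (Box Zero),
  Cantor.to_nat (1, Cantor.to_nat (Cantor.to_nat (4, Cantor.to_nat (c, sq (thead t))),
    Cantor.to_nat (4, Cantor.to_nat (sq (thead t), c)))))))) => [t|].
  by rewrite -sqE.
by do ![exact: mrec_const | exact: Hsq | apply: mrec_pair].
Qed.

(** Soundness uses only that [C] lies within [K_models A], completeness only that [C] has all chain
    models over [A]; every class in between is covered. *)
Lemma entails_rreach d (A : flewType d -> Prop) (C : kmodel d -> Prop) (x y z : nat) R n K :
  (forall B, A B -> flew_chain B) -> (forall B, A B -> weakly_saturated B) ->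
  (forall n, exists2 B, A B & ~ contractive n B) ->
  (forall M, C M -> K_models A M) ->
  (forall (B : flewType d) k (val : 'I_k.+1 -> nat -> B), A B -> C (chain_model val)) ->
  uniq [:: x; y; z] -> growing R ->
  ~ consequence C (start x z n :: theory x y z R) (goal x y z K) <->
  exists2 a, rreach R (2 ^ n) a & K %| a.
Proof.
move=> Ach Aws Anc CK chC uxyz gR; split.
  move=> /existsNP[M] /not_implyP[CM] /not_implyP[Hth Hg].
  have [AM S] := CK _ CM.
  exact: (theory_sound S (Ach _ AM) (Aws _ AM) gR Hth Hg).
move=> [a Ha Ka] Hcons; have [m Hm] := theory_complete uxyz gR Ha Ka.
have [B AB Bm] := Anc m.
have [k [val [Hth Hg]]] := Hm _ _ (Ach _ AB) Bm.
by apply: Hg; apply: Hcons => //; apply: chC.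
Qed.

Lemma over_vars_encoding (x y z : nat) R n K : 
  (forall g, List.In g (start x z n :: theory x y z R) -> over_vars [:: x; y; z] g) /\
  over_vars [:: x; y; z] (goal x y z K).
Proof.
have xv : x \in [:: x; y; z] by rewrite !inE eqxx.
have yv : y \in [:: x; y; z] by rewrite !inE eqxx orbT.
have zv : z \in [:: x; y; z] by rewrite !inE eqxx !orbT.
have powv f m : over_vars [:: x; y; z] f -> over_vars [:: x; y; z] (fpow f m).
  by move=> fv; elim: m => // m IHm; rewrite /fpow iterS.
have sqv m : over_vars [:: x; y; z] (iter m (fun f => Mul f f) (Var z)).
  by elim: m => // m IHm; rewrite iterS.
have stepv : over_vars [:: x; y; z] (step_formula x y z R).
  rewrite /step_formula.
  have : forall g, List.In g (flatten [seq rule_formulas x y z q | q <- R]) ->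
      over_vars [:: x; y; z] g.
    move=> g /In_rule_formulas[D [E [N [s [_ _ _ ->]]]]].
    by do ![split | exact: powv | done].
  elim: (flatten _) => [_|g l IHl Hl]; first by do ![split | done].
  by split; [apply: Hl; left | apply: IHl => h hl; apply: Hl; right].
have pK : over_vars [:: x; y; z] (fpow (Var y) K) by apply: powv.
split; last by do ![split | done].
by move=> g [<-|[<-|[<-|[<-|[<-|[<-|[<-|[]]]]]]]]; do ![split | done].
Qed.

Lemma undecidable_of_entails (L : logic) (x y z : nat) :
  (forall R n K, growing R ->
    ~ L (start x z n :: theory x y z R) (goal x y z K) <->
    exists2 a, rreach R (2 ^ n) a & K %| a) ->
  undecidable_logic L.
Proof.
move=> LE [f Hf].
have [h Hh] := mrec_diagonal_code x y z (pp 2).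
pose H := MComp f (fun _ : 'I_1 => h).
(* Input in register 0, output in register 1, scratch from 2 on. Neither [C] nor [R] depends on the
   input, so choosing [n] as the code of the theory of [R] is not circular. *)
pose C := flat_code (loop_program H [:: 0] 1 2) 0.
pose R := rules C 1; pose n := formulas_code (theory x y z R).
have halts v : computes f [tuple diagonal_code x y z (pp 2) n] v ->
    exists s, reaches C (init n) (size C, s) /\ s 1 = v.
  move=> Hv; exists (upd (init n).2 1 v); split; last by rewrite /upd eqxx.
  have HH : computes H [tuple n] v.
    by exists [tuple diagonal_code x y z (pp 2) n] => // i; rewrite ord1; apply: Hh.
  have /flat_code_correct : exec (loop_program H [:: 0] 1 2) (init n).2 (upd (init n).2 1 v).
    apply: (loop_program_correct HH); split=> //=.
    by move=> r Hr; rewrite /upd; case: eqP => // r0; lia.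
  by move=> /(_ [::] [::]); rewrite /= cats0 add0n.
have [H1 H0] := Hf (diagonal_code x y z (pp 2) n).
have := LE R n (pp 2) (@growing_rules C 1); rewrite (rreach_accept C 1 n).
(* If the consequence holds, [f] answers 1, the machine accepts, and by [LE] the consequence
   fails. *)
case: (pselect (L (start x z n :: theory x y z R) (goal x y z (pp 2)))) => HL.
  have [|s [Hs s1]] := halts 1; first by apply: H1; do 2!eexists; split; first exact: HL.
  by case=> _ /(_ (ex_intro2 _ _ s Hs _)); rewrite s1 => /(_ isT).
(* Otherwise [f] answers 0, as codes are injective; the accepting run given by [LE] would halt in
   the same state, whose output is 0. *)
have [|s [Hs s1]] := halts 0.
  apply: H0 => -[Gamma [g [HG]]] /to_nat_pair_inj [eG /formula_code_inj eg].
  apply: HL; rewrite eg.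
  by have /formulas_code_inj -> : formulas_code (start x z n :: theory x y z R) = formulas_code Gamma.
case=> /(_ HL) [s' Hs' s'1] _.
have halt s2 : step C (size C, s2) = None by rewrite /= onth_default.
have [ess] := reaches_halt Hs (halt s) Hs' (halt s').
by rewrite -ess s1 in s'1.
Qed.

Lemma undecidable_consequence d (A : flewType d -> Prop) (C : kmodel d -> Prop) :
  (forall B, A B -> flew_chain B) -> (forall B, A B -> weakly_saturated B) ->
  (forall n, exists2 B, A B & ~ contractive n B) ->
  (forall M, C M -> K_models A M) ->
  (forall (B : flewType d) k (val : 'I_k.+1 -> nat -> B), A B -> C (chain_model val)) ->
  undecidable_logic (consequence C) /\
  forall x y z : nat, uniq [:: x; y; z] ->
    undecidable_logic (fragment [:: x; y; z] (consequence C)).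
Proof.
move=> Ach Aws Anc CK chC.
have entails (x y z : nat) R n K := @entails_rreach d A C x y z R n K Ach Aws Anc CK chC.
split=> [|x y z uxyz].
  by apply: (@undecidable_of_entails _ 0 1 2) => R n K; apply: entails.
apply: (@undecidable_of_entails _ x y z) => R n K /(entails x y z R n K uxyz) <-.
have [gv fv] := over_vars_encoding x y z R n K.
by split=> H H'; apply: H; [split | case: H'].
Qed.

Lemma chain_frame_finite_chain k : finite_chain_frames (chain_frame k).
Proof. by exists k, id => //; exists id. Qed.

Theorem theorem3p1 (d : Order.disp_t) (A : flewType d -> Prop)
  (A_chain : forall B : flewType d, A B -> flew_chain B)
  (A_wsat : forall B : flewType d, A B -> weakly_saturated B)
  (A_ncontr : forall n : nat, exists2 B : flewType d, A B & ~ contractive n B) :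
  [/\ forall F : frame -> Prop, (forall G, finite_chain_frames G -> F G) ->
        undecidable_logic (consequence (frame_models F A)),
      undecidable_logic (consequence (K_models A)),
      undecidable_logic (consequence (finite_K_models A))
    & forall x y z : nat, uniq [:: x; y; z] ->
      [/\ forall F : frame -> Prop, (forall G, finite_chain_frames G -> F G) ->
            undecidable_logic
              (fragment [:: x; y; z] (consequence (frame_models F A))),
          undecidable_logic (fragment [:: x; y; z] (consequence (K_models A)))
        & undecidable_logic
            (fragment [:: x; y; z] (consequence (finite_K_models A)))]].
Proof.
have K_chain (B : flewType d) k (val : 'I_k.+1 -> nat -> B) : A B ->
    K_models A (chain_model val) by move=> AB; split=> //; apply: chain_safe.
have [K K3] := undecidable_consequence A_chain A_wsat A_ncontr (fun M H => H) K_chain.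
have [||wK wK3] := @undecidable_consequence d A (finite_K_models A) A_chain A_wsat A_ncontr.
- by move=> M [].
- by move=> B k val AB; split; [apply: K_chain | apply: finite_finset].
have frames (F : frame -> Prop) : (forall G, finite_chain_frames G -> F G) -> _ :=
  fun HF => @undecidable_consequence d A (frame_models F A) A_chain A_wsat A_ncontr
    (fun M H => proj1 H)
    (fun B k val AB => conj (K_chain B k val AB) (HF _ (chain_frame_finite_chain k))).
split=> // [F /frames[] //|x y z uxyz]; split; [|exact: K3|exact: wK3].
by move=> F /frames[_]; apply.
Qed.
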